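(* Let $n$ be a positive integer, $T_1,\ldots,T_n\in B(\mathcal H)$, and let $\mathcal S\subset C^*(S_1,\ldots,S_n)$ be the operator system $$\mathcal S:=\{p(S_1,\ldots,S_n)+q(S_1,\ldots,S_n)^*:\ p,q\in\mathcal P\}.$$ The following statements are equivalent: (i) $w(T_1,\ldots,T_n)\le1$; (ii) the map $\Psi:\mathcal S\to B(\mathcal H)$ defined by $$\Psi\big(p(S_1,\ldots,S_n)+q(S_1,\ldots,S_n)^*\big):=p(T_1,\ldots,T_n)+q(T_1,\ldots,T_n)^*+(p(0)+\overline{q(0)})I$$ is completely positive.
   Context: $\mathcal H$ is a complex Hilbert space. $H_n$ is an $n$-dimensional complex Hilbert space with orthonormal basis $e_1,\ldots,e_n$, and $F^2(H_n)=\bigoplus_{k\ge0}H_n^{\otimes k}$ ($H_n^{\otimes0}=\mathbb C1$) is the full Fock space. The left creation operators are $S_i\psi:=e_i\otimes\psi$, $\psi\in F^2(H_n)$; $C^*(S_1,\ldots,S_n)$ is the unital $C^*$-algebra they generate. $\mathbb F_n^+$ is the unital free semigroup on $g_1,\ldots,g_n$ with identity $g_0$; for $\alpha=g_{i_1}\cdots g_{i_k}$, $|\alpha|=k$, $e_\alpha=e_{i_1}\otimes\cdots\otimes e_{i_k}$, $T_\alpha=T_{i_1}\cdots T_{i_k}$; $|g_0|=0$, $e_{g_0}=1$, $T_{g_0}=I$. $\mathcal P$ is the set of polynomials $p=\sum_{|\alpha|\le m}a_\alpha e_\alpha$ (finite sums, $a_\alpha\in\mathbb C$) in $F^2(H_n)$;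 $p(T_1,\ldots,T_n):=\sum a_\alpha T_\alpha$ and $p(0):=a_{g_0}$. Joint numerical radius: $w(T_1,\ldots,T_n):=\sup\left|\sum_{\alpha\in\mathbb F_n^+}\sum_{j=1}^n\langle h_\alpha,T_jh_{g_j\alpha}\rangle\right|$, the supremum being over all families $\{h_\alpha\}_{\alpha\in\mathbb F_n^+}\subset\mathcal H$ with $\sum_\alpha\|h_\alpha\|^2=1$. *)

(* Defs.v *)
From HB Require Import structures.
From mathcomp Require Import all_boot all_order all_algebra finmap.
From mathcomp Require Import complex ring.
From mathcomp Require Import all_classical all_reals all_analysis.
From mathcomp.analysis Require showcase.summability.

Set Implicit Arguments.
Unset Strict Implicit.
Unset Printing Implicit Defensive.

Import Order.TTheory GRing.Theory Num.Theory.
Import numFieldNormedType.Exports.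

Local Open Scope classical_set_scope.
Local Open Scope complex_scope.
Local Open Scope ring_scope.

Local Notation totally := summability.totally.
Local Notation partial_sum := summability.partial_sum.
#[global] Existing Instance summability.totally_filter.

Section UnorderedSums.
Context {R : realType} {I : choiceType}.
Implicit Types (f g : I -> R[i]) (s t : R[i]) (A B : {fset I}).

(* Sums over an arbitrary index type, as limits of finite partial sums along
   the net of finite subsets. [R[i]^o] is [R[i]] seen as a normed module over
   itself, which is how it gets its usual topology. *)
Definition has_sum f s :=
  partial_sum (f : I -> R[i]^o) A @[A --> totally] --> (s : R[i]^o).

(* The value of the sum; it is meaningful only when [has_sum f] holds of some
   value, e.g. for absolutely summable families (lemma [abs_has_sum]). *)
Definition usum f : R[i] := summability.sum (f : I -> R[i]^o).

Lemma partial_sumE (V : zmodType) (f : I -> V) A :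
  partial_sum f A = \sum_(i <- A) f i.
Proof. by rewrite /summability.partial_sum big_seq_fsetE. Qed.

Lemma has_sum_usum f s : has_sum f s -> usum f = s.
Proof. exact: (@cvg_lim R[i]^o (@norm_hausdorff _ R[i]^o)). Qed.

Lemma has_sumD f g s t :
  has_sum f s -> has_sum g t -> has_sum (fun i => f i + g i) (s + t).
Proof.
move=> fs gt; rewrite /has_sum.
have -> : partial_sum (fun i => f i + g i : R[i]^o) =
    partial_sum (f : I -> R[i]^o) \+ partial_sum (g : I -> R[i]^o).
  by apply/funext => A; rewrite /= !partial_sumE big_split.
exact: (@cvgD _ R[i]^o).
Qed.

Lemma has_sumZ a f s : has_sum f s -> has_sum (fun i => a * f i) (a * s).
Proof.
move=> fs; rewrite /has_sum.
have -> : partial_sum (fun i => a * f i : R[i]^o) =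
    a \*: partial_sum (f : I -> R[i]^o).
  by apply/funext => A; rewrite /= !partial_sumE -mulr_sumr.
exact: (@cvgZl_tmp _ R[i]^o).
Qed.

Lemma has_sum_conj f s : has_sum f s -> has_sum (fun i => (f i)^*) s^*.
Proof.
move=> /cvgrPdist_le fs; apply/cvgrPdist_le => e /fs; apply: filterS => A.
by rewrite !partial_sumE -rmorph_sum -rmorphB norm_conjC.
Qed.

(* The squared modulus, with values in [R] rather than in [R[i]]. *)
Definition nrm2 (z : R[i]) : R := complex.Re z ^+ 2 + complex.Im z ^+ 2.

Lemma nrm2E z : `|z| ^+ 2 = (nrm2 z)%:C.
Proof. by rewrite -add_Re2_Im2. Qed.

Lemma nrm2_ge0 z : 0 <= nrm2 z.
Proof. by rewrite addr_ge0 ?sqr_ge0. Qed.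

Lemma nrm2_lin a z w : nrm2 (a * z + w) <= 2 * nrm2 a * nrm2 z + 2 * nrm2 w.
Proof.
case: a z w => [a b] [c d] [e f]; rewrite /nrm2 /=.
set u := a * c - b * d; set v := a * d + b * c.
have -> : 2 * (a ^+ 2 + b ^+ 2) * (c ^+ 2 + d ^+ 2) + 2 * (e ^+ 2 + f ^+ 2) =
    (u + e) ^+ 2 + (v + f) ^+ 2 + ((u - e) ^+ 2 + (v - f) ^+ 2).
  by rewrite /u /v; ring.
by rewrite lerDl addr_ge0// sqr_ge0.
Qed.

Definition bounded_sum (u : I -> R) := exists M, forall A, \sum_(i <- A) u i <= M.

Lemma bounded_sum_cvg (u : I -> R) : (forall i, 0 <= u i) -> bounded_sum u ->
  exists2 l, partial_sum u A @[A --> totally] --> l &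
    forall A, \sum_(i <- A) u i <= l.
Proof.
move=> u0 [M uM]; pose S := [set \sum_(i <- A) u i | A in [set: {fset I}]].
have supS : has_sup S.
  by split; [exists (\sum_(i <- fset0) u i); exists fset0|exists M => _ [A _ <-]].
have ub A : \sum_(i <- A) u i <= sup S by apply: sup_upper_bound => //; exists A.
exists (sup S) => //; apply/cvgrPdist_le => e e0.
have [_ [A0 _ <-] A0e] := sup_adherent e0 supS.
exists A0 => //= B A0B; rewrite partial_sumE ger0_norm ?subr_ge0//.
rewrite lerBlDl -lerBlDr; apply: (le_trans (ltW A0e)).
rewrite (big_fsetID _ (mem A0) B)/= (_ : [fset x in B | x \in A0]%fset = A0).
  by rewrite lerDl sumr_ge0.
by apply/fsetP => x; rewrite !inE/= andb_idl// => /(fsubsetP A0B).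
Qed.

Lemma cvg_complex T (F : set_system T) (FF : Filter F) (u v : T -> R) (a b : R) :
  u x @[x --> F] --> a -> v x @[x --> F] --> b ->
  (u x +i* v x : R[i]^o) @[x --> F] --> (a +i* b : R[i]^o).
Proof.
move=> /cvgrPdist_le ua /cvgrPdist_le vb; apply/cvgrPdist_le => e e0.
have er : (complex.Re e)%:C = e by apply: RRe_real; rewrite gtr0_real.
have e2 : 0 < complex.Re e / 2 by rewrite divr_gt0// -ltcR er.
near=> x.
have ux : `|a - u x| <= complex.Re e / 2 by near: x; exact: ua.
have vx : `|b - v x| <= complex.Re e / 2 by near: x; exact: vb.
have -> : (a +i* b : R[i]) - (u x +i* v x) = (a - u x)%:C + 'i%C * (b - v x)%:C.
  by simpc.
apply: (le_trans (ler_normD _ _)); rewrite normrM.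
have -> : `|'i%C : R[i]| = 1 by rewrite normc_def/= expr0n expr1n add0r sqrtr1.
rewrite mul1r !normc_def /= !expr0n !addr0 !sqrtr_sqr -rmorphD -[leRHS]er lecR.
by rewrite [leRHS]splitr lerD.
Unshelve. all: by end_near. Qed.

Lemma abs_bounded_cvg (u : I -> R) : bounded_sum (fun i => `|u i|) ->
  cvg (partial_sum u A @[A --> totally]).
Proof.
move=> bu; have [l ul _] := bounded_sum_cvg (fun i => normr_ge0 (u i)) bu.
have [i||m um _] := @bounded_sum_cvg (fun i => `|u i| + u i).
- by rewrite -lerBlDr sub0r (le_trans (ler_norm _))// normrN.
- have [M uM] := bu; exists (M + M) => A; rewrite big_split/= lerD//.
  by apply: (le_trans _ (uM A)); apply: ler_sum => i _; exact: ler_norm.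
apply/cvg_ex; exists (m - l).
have -> : partial_sum u =
    partial_sum (fun i => `|u i| + u i) \- partial_sum (fun i => `|u i|).
  apply/funext => A; rewrite /= !partial_sumE -sumrB.
  by apply: eq_bigr => i _; rewrite addrC addKr.
exact: cvgB.
Qed.

Lemma abs_has_sum f : bounded_sum (fun i => complex.Re `|f i|) ->
  has_sum f (usum f).
Proof.
move=> [M fM].
have Re_le z : `|complex.Re z| <= complex.Re `|z : R[i]|.
  by rewrite -lecR (RRe_real (normr_real _)) normc_ge_Re.
have Im_le z : `|complex.Im z| <= complex.Re `|z : R[i]|.
  by rewrite normc_def/= -sqrtr_sqr ler_wsqrtr// lerDr sqr_ge0.
have [|a fa] := (cvg_ex _).1 (@abs_bounded_cvg (fun i => complex.Re (f i)) _).
  by exists M => A; apply: (le_trans _ (fM A)); apply: ler_sum.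
have [|b fb] := (cvg_ex _).1 (@abs_bounded_cvg (fun i => complex.Im (f i)) _).
  by exists M => A; apply: (le_trans _ (fM A)); apply: ler_sum.
suff fs : has_sum f (a +i* b) by rewrite (has_sum_usum fs).
rewrite /has_sum (_ : partial_sum _ = fun A =>
  (partial_sum (fun i => complex.Re (f i)) A
    +i* partial_sum (fun i => complex.Im (f i)) A : R[i]^o)).
  exact: cvg_complex.
apply/funext => A; rewrite !partial_sumE.
apply: (big_ind3 (fun (x : R[i]) y z => x = y +i* z)) => //.
  by move=> ? ? ? ? ? ? -> ->.
by move=> i _; case: (f i).
Qed.

Lemma has_sum_nrm2 f (l : R) :
  partial_sum (fun i => nrm2 (f i)) A @[A --> totally] --> l ->
  has_sum (fun i => `|f i| ^+ 2) l%:C.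
Proof.
move=> fl; rewrite /has_sum (_ : partial_sum _ = fun A =>
  (partial_sum (fun i => nrm2 (f i)) A +i* 0 : R[i]^o)).
  by apply: cvg_complex => //; exact: cvg_cst.
apply/funext => A; rewrite !partial_sumE -[RHS]/(_%:C) rmorph_sum.
by apply: eq_bigr => i _; exact: nrm2E.
Qed.

Definition square_summable f := exists s, has_sum (fun i => `|f i| ^+ 2) s.

Lemma square_summableP f :
  square_summable f <-> bounded_sum (fun i => nrm2 (f i)).
Proof.
split=> [[s /cvgrPdist_le/(_ _ ltr01)[A0 _ fA]]|[M fM]].
  exists (complex.Re (`|s| + 1)) => A.
  have {fA} /= := fA (A `|` A0)%fset (fsubsetUr _ _); rewrite partial_sumE => fA.
  have sr : (complex.Re (`|s| + 1))%:C = `|s| + 1.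
    by apply: RRe_real; rewrite rpredD ?rpred1 ?normr_real.
  rewrite -lecR sr rmorph_sum/=.
  apply: (@le_trans _ _ (\sum_(i <- (A `|` A0)%fset) `|f i| ^+ 2)).
    rewrite (big_fsetID _ (mem A) (A `|` A0)%fset)/=.
    rewrite (_ : [fset x in (A `|` A0)%fset | x \in A]%fset = A); last first.
      by apply/fsetP => x; rewrite !inE/= andb_idl// => ->.
    rewrite -[leLHS]addr0 lerD//; last by rewrite sumr_ge0// => i _; rewrite exprn_ge0.
    by apply: ler_sum => i _; rewrite nrm2E.
  rewrite -[leLHS]ger0_norm; last by rewrite sumr_ge0// => i _; rewrite exprn_ge0.
  by rewrite -lerBlDl (le_trans (lerB_dist _ _))// distrC.
have [l ul _] := bounded_sum_cvg (fun i => nrm2_ge0 (f i)) (ex_intro _ M fM).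
by exists l%:C; exact: has_sum_nrm2.
Qed.

End UnorderedSums.

(* A complex Hilbert space: a complex Banach space whose norm comes from an
   inner product. [{dot H for Num.conj}] is the type of positive definite
   Hermitian forms, linear in the first argument. *)
HB.mixin Record CompleteNormedModule_isHilbert (R : realType) H
    & CompleteNormedModule R[i] H := {
  hdot : {dot H for Num.conj};
  hdotxx : forall x : H, hdot x x = `|x| ^+ 2
}.

#[short(type="hilbertType")]
HB.structure Definition Hilbert (R : realType) :=
  {H of CompleteNormedModule R[i] H & CompleteNormedModule_isHilbert R H}.

Notation "''[' x , y ]" := (hdot x y) : ring_scope.

Section Ell2Type.
Context (R : realType) (I : choiceType).

Definition ell2_pred : {pred I -> R[i]} := fun x => `[< square_summable x >].

Record ell2 := Ell2 {
  ell2_val :> I -> R[i];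
  _ : ell2_val \in ell2_pred }.

HB.instance Definition _ := [isSub for ell2_val].
HB.instance Definition _ := [Choice of ell2 by <:].

Lemma ell2_submod_closed : submod_closed ell2_pred.
Proof.
split; first by apply/asboolP/square_summableP; exists 0 => A;
  rewrite big1// => i _; rewrite /nrm2 /= expr0n addr0.
move=> a x y /asboolP/square_summableP[M xM] /asboolP/square_summableP[N yN].
apply/asboolP/square_summableP; exists (2 * nrm2 a * M + 2 * N) => A.
apply: (@le_trans _ _ (2 * nrm2 a * (\sum_(i <- A) nrm2 (x i)) +
  2 * (\sum_(i <- A) nrm2 (y i)))); last first.
  by rewrite lerD// ler_wpM2l// mulr_ge0 ?nrm2_ge0.
rewrite !mulr_sumr -big_split/=; apply: ler_sum => i _.
exact: nrm2_lin.
Qed.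

HB.instance Definition _ :=
  GRing.isSubmodClosed.Build _ _ ell2_pred ell2_submod_closed.
HB.instance Definition _ := [SubChoice_isSubLmodule of ell2 by <:].

Definition ell2_dot (x y : ell2) : R[i] := usum (fun i => x i * (y i)^*).

End Ell2Type.

Section Ell2Dot.
Context {R : realType} {I : choiceType}.
Implicit Types x y z : ell2 R I.

Lemma ell2P x : square_summable x.
Proof. exact/asboolP/(valP x). Qed.

Lemma ell2_dotP x y : has_sum (fun i => x i * (y i)^*) (ell2_dot x y).
Proof.
apply: abs_has_sum.
have [M xM] := (square_summableP _).1 (ell2P x).
have [N yN] := (square_summableP _).1 (ell2P y).
exists (M + N) => A; apply: (le_trans _ (lerD (xM A) (yN A))).
rewrite -big_split; apply: ler_sum => i _.
have -> : complex.Re `|x i * (y i)^*| = Normc.normc (x i) * Normc.normc (y i).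
  by rewrite normrM norm_conjC -rmorphM.
rewrite -lecR rmorphM rmorphD/= -!nrm2E.
have : 0 <= (`|x i| - `|y i|) ^+ 2 by rewrite -realEsqr rpredB ?normr_real.
rewrite sqrrB addrAC subr_ge0; apply: le_trans.
by rewrite mulr2n lerDl mulr_ge0.
Qed.

Arguments ell2_dotP : clear implicits.

Lemma ell2_dotE x y s : has_sum (fun i => x i * (y i)^*) s -> ell2_dot x y = s.
Proof. exact: has_sum_usum. Qed.

Lemma ell2_dotC x y : ell2_dot x y = (ell2_dot y x)^*.
Proof.
apply: ell2_dotE; have := has_sum_conj (ell2_dotP y x).
by under eq_fun do rewrite rmorphM/= conjCK mulrC.
Qed.

Lemma ell2_dot_linear z : linear_for *%R ((@ell2_dot R I)^~ z).
Proof.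
move=> a x y; apply: ell2_dotE.
have := has_sumD (has_sumZ (a := a) (ell2_dotP x z)) (ell2_dotP y z).
by under eq_fun do rewrite mulrA -mulrDl.
Qed.

Lemma ell2_dot_bilinear :
  bilinear_for *%R (Num.conj \; *%R) (@ell2_dot R I).
Proof.
split=> [z|z a x y]; first exact: ell2_dot_linear.
rewrite ell2_dotC ell2_dot_linear rmorphD rmorphM/=.
by rewrite -!ell2_dotC.
Qed.

Lemma ell2_dotxxE x : exists2 l : R, ell2_dot x x = l%:C &
  partial_sum (fun i => nrm2 (x i)) A @[A --> totally] --> l /\
  forall A : {fset I}, \sum_(i <- A) nrm2 (x i) <= l.
Proof.
have bx := (square_summableP _).1 (ell2P x).
have [l xl lx] := bounded_sum_cvg (fun i => nrm2_ge0 (x i)) bx.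
exists l => //; apply: ell2_dotE; have := has_sum_nrm2 xl.
by under eq_fun do rewrite normCK.
Qed.

Lemma ell2_dotxx_gt0 x : x != 0 -> 0 < ell2_dot x x.
Proof.
move=> x0; have [i xi0] : exists i, x i != 0.
  apply: contrapT => /forallNP xi; case/negP: x0; apply/eqP/val_inj/funext => i.
  by apply/eqP; apply: contrapT => /negP; exact: xi.
have [l -> [_ /(_ [fset i]%fset)]] := ell2_dotxxE x.
rewrite -lecR; apply: lt_le_trans; rewrite big_seq_fset1 -nrm2E.
by rewrite exprn_gt0// normr_gt0.
Qed.

HB.instance Definition _ := bilinear_isBilinear.Build _ _ _ _ _ _
  (@ell2_dot R I) ell2_dot_bilinear.
Lemma ell2_dot_herm x y : ell2_dot x y = (-1) ^+ false * (ell2_dot y x)^*.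
Proof. by rewrite mul1r -ell2_dotC. Qed.
HB.instance Definition _ := isHermitianSesquilinear.Build _ _ _ _
  (@ell2_dot R I) ell2_dot_herm.
HB.instance Definition _ := isDotProduct.Build _ _
  (@ell2_dot R I) ell2_dotxx_gt0.

End Ell2Dot.

Section DotNorm.
Context (C : numClosedFieldType) (U : lmodType C) (f : {dot U for Num.conj}).

Lemma dot_CauchySchwarz u v : `|f u v| ^+ 2 <= f u u * f v v.
Proof.
have [->|v0] := eqVneq v 0; first by rewrite !linear0r normr0 expr0n.
have vgt0 : 0 < f v v by rewrite dnorm_gt0.
have vr : (f v v)^* = f v v by rewrite conj_Creal// gtr0_real.
set t := f u v / f v v.
have := dnorm_ge0 f (u - t *: v).
rewrite dnormB dnormZ linearZr_LR/=.
have -> : t^* * f u v = `|f u v| ^+ 2 / f v v.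
  by rewrite /t rmorphM/= fmorphV/= vr normCK mulrAC [f u v * _]mulrC.
have -> : `|t| ^+ 2 * f v v = `|f u v| ^+ 2 / f v v.
  by rewrite /t normrM normfV (gtr0_norm vgt0); field; rewrite gt_eqF.
rewrite rmorphM/= fmorphV/= vr rmorphXn/= conj_Creal ?normr_real//.
by rewrite opprD addrA addrK subr_ge0 ler_pdivrMr.
Qed.

Lemma dot_ler_normD u v :
  sqrtC (f (u + v) (u + v)) <= sqrtC (f u u) + sqrtC (f v v).
Proof.
rewrite -ler_sqr ?nnegrE ?addr_ge0 ?sqrtC_ge0 ?dnorm_ge0//.
rewrite sqrrD !sqrtCK dnormD [leRHS]addrAC lerD2l.
apply: (@le_trans _ _ (`|f u v| *+ 2)).
  apply: (le_trans (real_ler_norm _)).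
    by rewrite CrealE rmorphD/= conjCK addrC.
  by rewrite mulr2n (le_trans (ler_normD _ _))// norm_conjC.
rewrite lerMn2r/= -[leLHS](sqrCK (normr_ge0 _)) -sqrtCM ?nnegrE ?dnorm_ge0//.
by rewrite ler_sqrtC ?nnegrE ?exprn_ge0 ?mulr_ge0 ?dnorm_ge0// dot_CauchySchwarz.
Qed.

End DotNorm.

Section Ell2Hilbert.
Context {R : realType} {I : choiceType}.
Implicit Types x y z : ell2 R I.

Definition ell2_norm x : R[i] := sqrtC (ell2_dot x x).

Lemma ell2_ler_normD x y : ell2_norm (x + y) <= ell2_norm x + ell2_norm y.
Proof. exact: (@dot_ler_normD _ _ (@ell2_dot R I)). Qed.

Lemma ell2_normrZ a x : ell2_norm (a *: x) = `|a| * ell2_norm x.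
Proof.
rewrite /ell2_norm (dnormZ (@ell2_dot R I)) sqrtCM ?nnegrE ?exprn_ge0//.
by rewrite sqrCK.
Qed.

Lemma ell2_normr0_eq0 x : ell2_norm x = 0 -> x = 0.
Proof.
by move/eqP; rewrite sqrtC_eq0 (dnorm_eq0 (@ell2_dot R I)) => /eqP.
Qed.

HB.instance Definition _ := Lmodule_isNormed.Build R[i] (ell2 R I)
  ell2_ler_normD ell2_normrZ ell2_normr0_eq0.

Lemma ell2_dot_norm x : ell2_dot x x = `|x| ^+ 2.
Proof. by rewrite sqrtCK. Qed.

Lemma ell2_norm_leP x (e : R) : 0 <= e ->
  `|x| <= e%:C <-> forall A : {fset I}, \sum_(i <- A) nrm2 (x i) <= e ^+ 2.
Proof.
move=> e0; rewrite -ler_sqr ?nnegrE ?ler0c// -ell2_dot_norm.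
have [l -> [xl lx]] := ell2_dotxxE x.
rewrite -rmorphXn lecR; split=> [le A|xe]; first exact: le_trans (lx A) le.
by apply: (cvgr_to_le xl); near=> A; rewrite partial_sumE.
Unshelve. all: by end_near. Qed.

Lemma ell2_complete (F : set_system (ell2 R I)) :
  ProperFilter F -> cauchy F -> cvg F.
Proof.
move=> FF /cauchy_ballP Fc.
have Fe (e : R) : 0 < e -> exists2 P, F P &
    forall x y, P x -> P y -> forall A : {fset I},
      \sum_(i <- A) nrm2 (x i - y i) <= e ^+ 2.
  move=> e0; have := Fc e%:C; rewrite ltcR => /(_ e0)[[P Q] /= [FP FQ] PQ].
  exists (P `&` Q) => [|x y [Px _] [_ Qy]]; first exact: filterI.
  have := PQ (x, y) (conj Px Qy); rewrite -ball_normE/= => /ltW.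
  by move/(ell2_norm_leP _ (ltW e0)).
have coord (h : R[i] -> R) : (forall u v, h (u - v) = h u - h v) ->
    (forall u, `|h u| ^+ 2 <= nrm2 u) ->
    forall i, exists l : R, (fun x : ell2 R I => h (x i)) @ F --> l.
  move=> hB hle i.
  suff : cvg ((fun x : ell2 R I => h (x i)) @ F) by move=> /cvg_ex[l xl]; exists l.
  apply: cauchy_cvg; apply/cauchy_ballP => e e0.
  have [P FP Pe] := Fe (e / 2) (divr_gt0 e0 (ltr0n _ 2)).
  pose Q := [set h (x i) | x in P].
  have FQ : F [set x : ell2 R I | Q (h (x i))].
    by apply: filterS FP => x Px; exists x.
  exists (Q, Q); first by split.
  move=> [_ _] /= [[x Px <-] [y Py <-]]; rewrite /ball/= -hB.
  have e2 : 0 <= e / 2 by rewrite divr_ge0 ?ltW.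
  apply: (@le_lt_trans _ _ (e / 2)); last first.
    by rewrite ltr_pdivrMr// ltr_pMr// ltr1n.
  rewrite -ler_sqr ?nnegrE//; apply: (le_trans (hle _)).
  by have := Pe _ _ Px Py [fset i]%fset; rewrite big_seq_fset1.
have /choice[a la] i : exists l : R, (fun x : ell2 R I => complex.Re (x i)) @ F --> l.
  apply: coord => [[? ?] [? ?]//|u].
  by rewrite real_normK ?num_real// lerDl sqr_ge0.
have /choice[b lb] i : exists l : R, (fun x : ell2 R I => complex.Im (x i)) @ F --> l.
  apply: coord => [[? ?] [? ?]//|u].
  by rewrite real_normK ?num_real// lerDr sqr_ge0.
pose l i := a i +i* b i.
have lim_le (e : R) : 0 < e -> exists2 P, F P &
    forall x, P x -> forall A : {fset I}, \sum_(i <- A) nrm2 (x i - l i) <= e ^+ 2.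
  move=> /Fe[P FP Pe]; exists P => // x Px A.
  have cvgl : (fun y : ell2 R I => \sum_(i <- A) nrm2 (x i - y i)) @ F -->
      \sum_(i <- A) nrm2 (x i - l i).
    apply: cvg_big => [|i _]; first exact: add_continuous.
    have -> : nrm2 (x i - l i) =
        (complex.Re (x i) - a i) ^+ 2 + (complex.Im (x i) - b i) ^+ 2.
      by rewrite /nrm2; case: (x i).
    have -> : (fun y : ell2 R I => nrm2 (x i - y i)) = fun y : ell2 R I =>
        (complex.Re (x i) - complex.Re (y i)) ^+ 2 +
        (complex.Im (x i) - complex.Im (y i)) ^+ 2.
      by apply/funext => y; rewrite /nrm2; case: (x i) (y i) => ? ? [].
    apply: cvgD.
      by apply: cvgM; apply: cvgB => //; exact: cvg_cst.
    by apply: cvgM; apply: cvgB => //; exact: cvg_cst.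
  by apply: (cvgr_to_le cvgl); apply: filterS FP => y Py; exact: Pe.
have ssl : l \in @ell2_pred R I.
  have [P FP Pe] := lim_le 1 ltr01.
  have [x Px] := filter_ex FP.
  have d_in : (fun i => x i - l i) \in @ell2_pred R I.
    by apply/asboolP/square_summableP; exists (1 ^+ 2); exact: Pe.
  have -> : l = (x : I -> R[i]) - (fun i => x i - l i).
    by apply/funext => i; rewrite -[RHS]/(x i - (x i - l i)) subKr.
  by apply: rpredB => //; exact: (valP x).
apply/cvg_ex; exists (Ell2 ssl : ell2 R I).
apply/cvgrPdist_le => e e0.
have er : (complex.Re e)%:C = e by apply: RRe_real; rewrite gtr0_real.
have er0 : 0 < complex.Re e by rewrite -ltcR er.
have [P FP Pe] := lim_le _ er0.
apply: filterS FP => x Px; rewrite distrC -er.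
by apply/ell2_norm_leP; [exact: ltW|exact: Pe].
Qed.

HB.instance Definition _ := Uniform_isComplete.Build (ell2 R I) ell2_complete.
HB.instance Definition _ := CompleteNormedModule_isHilbert.Build R (ell2 R I)
  ell2_dot_norm.

End Ell2Hilbert.

Section Operators.
Context {R : realType}.

Definition is_adjoint (H K : hilbertType R) (A : H -> K) (B : K -> H) :=
  forall x y, '[A x, y] = '[x, B y].

(* The Hilbert space adjoint [A^*]. For bounded linear [A] the operator [B]
   exists by Riesz representation, and it is always unique; the default value 0
   is only reached for functions that have no adjoint. *)
Definition adjoint (H K : hilbertType R) (A : H -> K) : K -> H :=
  xget (fun=> 0) [set B | is_adjoint A B].

(* Positivity of an m x m matrix of operators, as an operator on the m-fold
   direct sum of H; [0 <= z] in [R[i]] means that [z] is real and nonnegative.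
   For matrices over a concrete C*-algebra of operators this is positivity in
   the C*-algebra of matrices. *)
Definition pos_opmx (H : hilbertType R) m (A : 'M[H -> H]_m) :=
  forall x : 'I_m -> H, 0 <= \sum_i \sum_j '[A i j (x j), x i].

(* [Phi] is only looked at on the operator space [S]. *)
Definition completely_positive (K H : hilbertType R) (S : set (K -> K))
    (Phi : (K -> K) -> (H -> H)) :=
  forall m (A : 'M[K -> K]_m), (forall i j, S (A i j)) ->
    pos_opmx A -> pos_opmx (map_mx Phi A).

End Operators.

(* The free semigroup on n generators is [seq 'I_n] with concatenation and unit
   [[::]]. A polynomial is its finitely supported family of coefficients, so
   that its constant term p(0) is [p [::]]. *)
Notation ncpoly R n := {fsfun seq 'I_n -> R[i] with 0}.

Definition wordop (V : Type) n (T : 'I_n -> V -> V) (a : seq 'I_n) : V -> V :=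
  foldr (fun i f => T i \o f) id a.

Definition polyop (R : realType) (V : lmodType R[i]) n (T : 'I_n -> V -> V)
    (p : ncpoly R n) : V -> V :=
  fun x => \sum_(a <- finsupp p) p a *: wordop T a x.

(* The sum over words converges absolutely, by the Cauchy-Schwarz inequality.
   If H = 0 there is no admissible family and the supremum is -oo. *)
Definition joint_numerical_radius (R : realType) (H : hilbertType R) n
    (T : 'I_n -> H -> H) : \bar R :=
  ereal_sup [set (complex.Re
      `|usum (fun a => \sum_(j < n) '[h a, T j (h (j :: a))])|)%:E
    | h in [set h : seq 'I_n -> H | has_sum (fun a => `|h a| ^+ 2) 1]].

(* The full Fock space of an n-dimensional Hilbert space with orthonormal basis
   e_i: the tensors e_a, for a a word of length k, are an orthonormal basis of
   the k-th tensor power, and a vector of the Hilbert direct sum is given by its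
   square-summable family of coordinates in the e_a. *)
Notation fock R n := (ell2 R (seq 'I_n)).

Section Fock.
Context {R : realType} {n : nat}.

(* The coordinates of e_i (x) x: since e_i (x) e_b = e_(i :: b), the one at
   [i :: b] is [x b], and those at the words not starting with i vanish. *)
Definition creation_coef (i : 'I_n) (x : fock R n) (a : seq 'I_n) : R[i] :=
  if a is j :: b then if j == i then x b else 0 else 0.

Lemma creation_subproof i x : creation_coef i x \in @ell2_pred R (seq 'I_n).
Proof.
apply/asboolP/square_summableP.
have [M xM] := (square_summableP _).1 (ell2P x); exists M => A.
have nrm20 : nrm2 (0 : R[i]) = 0 by rewrite /nrm2 expr0n addr0.
rewrite (bigID [pred a | ohead a == Some i])/= [X in _ + X]big1 ?addr0; last first.
  by case=> [|j b] //=; rewrite /creation_coef (inj_eq Some_inj) => /negPf->.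
pose s := [seq behead a | a <- A & ohead a == Some i].
have us : uniq s.
  rewrite map_inj_in_uniq; first by apply: filter_uniq; exact: fset_uniq.
  move=> [|j b] [|k c]; rewrite !mem_filter//= !(inj_eq Some_inj).
  by move=> /andP[/eqP-> _] /andP[/eqP-> _] ->.
apply: le_trans (xM [fset b in s]%fset).
rewrite [leRHS](perm_big s); last first.
  apply: uniq_perm => //; first exact: fset_uniq.
  by move=> b; rewrite in_fset.
rewrite big_map big_filter le_eqVlt; apply/orP; left; apply/eqP.
apply: eq_bigr => -[|j b] //=; rewrite (inj_eq Some_inj) => /eqP ->.
by rewrite eqxx.
Qed.

Definition creation i x : fock R n := Ell2 (creation_subproof i x).

End Fock.

Definition opsystem (R : realType) n : set (fock R n -> fock R n) :=
  [set s | exists p q : ncpoly R n,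
     s = polyop creation p \+ adjoint (polyop creation q)].

(* Main.v *)
(* Put [(X g)_a = sum_j T_j g_(a j)]. Up to reversing words and rotating g_a by
   z^|a|, the condition w(T) <= 1 says that 2 I - X - X^* >= 0 on finitely
   supported families. The Toeplitz kernel K(a, b) = Psi(S_a^* S_b) satisfies
   K = (I - X^* )^-1 (2 I - X - X^* ) (I - X)^-1, so that w(T) <= 1 if and only if
   K >= 0. Applying (ii) to the positive matrix [S_a^* S_b] shows that (ii)
   implies K >= 0. Conversely, fix finitely many vectors x_j of H and a degree d.
   The Gram matrix K(a, b) at the x_j, for |a|, |b| <= d, is realized by vectors
   of some C^L, on which the left shifts act as partial isometries B_g with
   orthogonal ranges. For r < 1 the Poisson kernel of r B embeds C^L into copies of
   the Fock space and intertwines S_c with r^|c| B_c; hence positivity of a matrix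
   over the operator system passes from the S_g to the r B_g, and to Psi as
   r -> 1. *)
Require Import Defs.
From HB Require Import structures.
From mathcomp Require Import all_boot all_order all_algebra finmap.
From mathcomp Require Import complex ring lra zify.
From mathcomp Require Import all_classical all_reals all_analysis.
From mathcomp.analysis Require showcase.summability.

Set Implicit Arguments.
Unset Strict Implicit.
Unset Printing Implicit Defensive.

Import Order.TTheory GRing.Theory Num.Theory.
Import numFieldNormedType.Exports.

Local Open Scope classical_set_scope.
Local Open Scope complex_scope.
Local Open Scope ring_scope.

(** * Adjoint matrices and Gram factorizations *)

Section Adj.
Local Open Scope sesquilinear_scope.
Context {C : numClosedFieldType}.

Lemma trmxC_mul m n p (A : 'M[C]_(m, n)) (B : 'M[C]_(n, p)) :
  (A *m B)^t* = B^t* *m A^t*.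
Proof. by rewrite trmx_mul map_mxM. Qed.

Lemma trmxCZ m p (x : C) (A : 'M[C]_(m, p)) : (x *: A)^t* = x^* *: A^t*.
Proof. by rewrite linearZ/= map_mxZ. Qed.

Lemma trmxCB m p (A A' : 'M[C]_(m, p)) : (A - A')^t* = A^t* - A'^t*.
Proof. by rewrite linearB/= map_mxB. Qed.

Lemma trmxCD m p (A A' : 'M[C]_(m, p)) : (A + A')^t* = A^t* + A'^t*.
Proof. by rewrite linearD/= map_mxD. Qed.

Lemma trmxC1 m : (1%:M : 'M[C]_m)^t* = 1%:M.
Proof. by rewrite trmx1 map_mx1. Qed.

Lemma mulmx_trmxCE m n p (A : 'M[C]_(m, n)) (B : 'M[C]_(p, n)) i j :
  (A *m B^t*) i j = \sum_k A i k * (B j k)^*.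
Proof. by rewrite !mxE; apply: eq_bigr => k _; rewrite !mxE. Qed.

Lemma mulmxt_eq0 m n (A : 'M[C]_(m, n)) : A *m A^t* = 0 -> A = 0.
Proof.
move=> A0; apply/matrixP => i j; apply/eqP; rewrite !mxE -normr_eq0.
have := mulmx_trmxCE A A i i; rewrite A0 mxE => /esym/eqP.
under eq_bigr do rewrite -normCK.
rewrite psumr_eq0 => [/allP/(_ j)|k _]; last by rewrite exprn_ge0.
by rewrite mem_index_enum/= expf_eq0/= => ->.
Qed.

(** By the spectral theorem k is unitarily equivalent to a nonnegative diagonal matrix; G is the
    adjoint of the unitary times the square root of the diagonal. *)
Lemma gram_factor L (k : 'M[C]_L) : k^t* = k ->
  (forall u : 'rV_L, 0 <= (u *m k *m u^t*) 0 0) -> exists G : 'M[C]_L, G *m G^t* = k.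
Proof.
move=> kh kp.
have kn : k \is normalmx by apply/normalmxP; rewrite kh.
have /orthomx_spectralP ek := kn.
set U := spectralmx k in ek; set D := spectral_diag k in ek.
have Uu : U \is unitarymx by exact: spectral_unitarymx.
have {}ek : k = U^t* *m diag_mx D *m U by rewrite ek invmx_unitary.
have D0 i : 0 <= D 0 i.
  have := kp (delta_mx 0 i *m U).
  rewrite trmxC_mul ek !mulmxA !mulmxtVK// trmx_delta map_delta_mx.
  by rewrite -rowE -colE !mxE eqxx mulr1n.
exists (U^t* *m diag_mx (map_mx sqrtC D)).
rewrite trmxC_mul trmxCK ek !mulmxA; congr (_ *m _).
rewrite -!mulmxA; congr (_ *m _).
rewrite tr_diag_mx map_diag_mx mulmx_diag; congr diag_mx.
apply/rowP => i; rewrite !mxE /= conj_Creal ?ger0_real ?sqrtC_ge0//.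
by rewrite -expr2 sqrtCK.
Qed.

(** Gram-Schmidt applied to a basis of the row space. The matrices A and E translate between the
    rows of M and the orthonormal rows of N. *)
Lemma unitary_row_basis r L (M : 'M[C]_(r, L)) :
  exists d (N : 'M[C]_(d, L)) (A : 'M[C]_(r, d)) (E : 'M[C]_(d, r)),
    [/\ N *m N^t* = 1%:M, M = A *m N & N = E *m M].
Proof.
pose N := schmidt (row_base M).
have NM : (N :=: M)%MS.
  apply: eqmx_trans (eq_row_base M).
  by apply: eqmx_schmidt_free; exact: row_base_free.
have /submxP[A MA] : (M <= N)%MS by rewrite NM.
have /submxP[E NE] : (N <= M)%MS by rewrite NM.
exists (\rank M), N, A, E; split => //.
by apply/unitarymxP/schmidt_unitarymx; exact: rank_leq_col.
Qed.

(* The isometries defined by [M |-> G g] on the row space of [M] are extended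
   by zero to its orthogonal complement. *)
Lemma gram_isometries r L n (M : 'M[C]_(r, L)) (G : 'I_n -> 'M[C]_(r, L)) :
  (forall g h, G g *m (G h)^t* = if g == h then M *m M^t* else 0) ->
  exists B : 'I_n -> 'M[C]_L, let Z := \sum_g (B g)^t* *m B g in
    (forall g, M *m B g = G g) /\ Z *m Z = Z.
Proof.
move=> GM; have [d [N [A [E [NN MA NE]]]]] := unitary_row_basis M.
pose F g := E *m G g.
have FF g h : F g *m (F h)^t* = if g == h then 1%:M else 0.
  rewrite trmxC_mul mulmxA -[E *m _ *m _]mulmxA GM; case: eqP => _.
    by rewrite mulmxA -NE -mulmxA -trmxC_mul -NE.
  by rewrite mulmx0 mul0mx.
have BB g : (N^t* *m F g)^t* *m (N^t* *m F g) = (F g)^t* *m F g.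
  by rewrite trmxC_mul trmxCK !mulmxA -[_ *m N *m _]mulmxA NN mulmx1.
exists (fun g => N^t* *m F g) => /=; split=> [g|].
  have AEM : A *m E *m M = M by rewrite -mulmxA -NE -MA.
  rewrite {1}MA mulmxA -[_ *m N *m _]mulmxA NN mulmx1 mulmxA.
  (* [G g - A *m E *m G g] vanishes because its Gram matrix does: [G g] has the Gram matrix of M,
     and [1 - A *m E] annihilates M. *)
  apply/esym/eqP; rewrite -subr_eq0; apply/eqP/mulmxt_eq0.
  have -> : G g - A *m E *m G g = (1%:M - A *m E) *m G g.
    by rewrite mulmxBl mul1mx.
  rewrite trmxC_mul mulmxA -[_ *m G g *m _]mulmxA GM eqxx.
  by rewrite mulmxA mulmxBl mul1mx AEM subrr !mul0mx.
under eq_bigr do rewrite BB.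
rewrite mulmx_suml; apply: eq_bigr => g _.
rewrite mulmx_sumr (bigD1 g)//= big1 => [|h hg].
  by rewrite addr0 mulmxA -[_ *m F g *m _]mulmxA FF eqxx mulmx1.
by rewrite mulmxA -[_ *m F g *m _]mulmxA FF eq_sym (negPf hg) mulmx0 mul0mx.
Qed.
End Adj.

(** * Sums over words *)

Section Words.
Variable n : nat.

Fixpoint words d : seq (seq 'I_n) :=
  if d is d'.+1 then [::] :: [seq g :: a | g <- enum 'I_n, a <- words d']
  else [::].

Lemma big_words (V : nmodType) d (F : seq 'I_n -> V) :
  \sum_(a <- words d.+1) F a = F [::] + \sum_g \sum_(a <- words d) F (g :: a).
Proof. by rewrite big_cons big_allpairs_dep big_enum. Qed.

Lemma mem_words d a : (a \in words d) = (size a < d)%N.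
Proof.
elim: d a => [|d IH] [|g a]//=; rewrite in_cons/= ltnS -IH.
apply/allpairsP/idP => [[[h b]/= [_ bd [_ ->]]]//|ad].
by exists (g, a); rewrite /= mem_enum.
Qed.

Lemma words_uniq d : uniq (words d).
Proof.
elim: d => //= d IH; apply/andP; split.
  by apply/negP => /allpairsP[[g a] [_ _]].
apply: allpairs_uniq => //; first exact: enum_uniq.
by move=> [g a] [h b] _ _ /= [-> ->].
Qed.

Lemma mem_words_cat d a b : (a ++ b \in words d) = (b \in words (d - size a)).
Proof. by rewrite !mem_words size_cat ltn_subRL. Qed.

End Words.

(** * The Poisson kernel of a row of partial isometries *)

Section Poisson.
Local Open Scope sesquilinear_scope.
Context {C : numClosedFieldType} {L n : nat}.
Variables (B : 'I_n -> 'M[C]_L) (r : C).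
Hypotheses (r0 : 0 <= r) (r1 : r <= 1).

(** Matrices act on row vectors from the right, so the product is taken in reverse order: the last
    letter acts first, as in [wordop]. *)
Definition wordmx (a : seq 'I_n) : 'M[C]_L := foldr (fun g M => M *m B g) 1%:M a.

Lemma wordmx_cat a b : wordmx (a ++ b) = wordmx b *m wordmx a.
Proof.
by elim: a => [|g a IH] /=; rewrite ?mulmx1// IH mulmxA.
Qed.

(* [remainder N] is the sum of [(wordmx a)^* wordmx a] over the words a of
   length N. *)
Fixpoint remainder (N : nat) : 'M[C]_L :=
  if N is N'.+1 then \sum_g (B g)^t* *m remainder N' *m B g else 1%:M.

Let Z := \sum_g (B g)^t* *m B g.
Hypothesis ZZ : Z *m Z = Z.

(* The square root of [1 - r^2 Z]. *)
Definition defect : 'M[C]_L := (1%:M - Z) + sqrtC (1 - r ^+ 2) *: Z.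

Lemma Z_herm : Z^t* = Z.
Proof.
rewrite /Z linear_sum/= raddf_sum/=; apply: eq_bigr => g _.
by rewrite trmxC_mul trmxCK.
Qed.

(** [1 - Z] and [Z] are complementary orthogonal projections, so the square is [1 - Z] plus
    [(1 - r^2) Z]. *)
Lemma defect_sqr : defect *m defect^t* = 1%:M - r ^+ 2 *: Z.
Proof.
have s0 : 0 <= 1 - r ^+ 2 by rewrite subr_ge0 exprn_ile1.
rewrite /defect trmxCD trmxCB trmxCZ trmxC1 Z_herm.
rewrite conj_Creal ?ger0_real ?sqrtC_ge0//.
set P := 1%:M - Z; set s := sqrtC _.
have ZP : Z *m P = 0 by rewrite mulmxBr mulmx1 ZZ subrr.
have PZ : P *m Z = 0 by rewrite mulmxBl mul1mx ZZ subrr.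
have PP : P *m P = P by rewrite {1}/P mulmxBl mul1mx ZP subr0.
have P1 : P + Z = 1%:M by rewrite subrK.
clearbody P.
rewrite mulmxDl !mulmxDr -!scalemxAl -!scalemxAr ZP PZ PP ZZ !scaler0 addr0 add0r.
by rewrite scalerA -expr2 sqrtCK scalerBl scale1r addrA P1.
Qed.

(** The sum telescopes: the empty word gives [1 - r^2 Z], and the words starting with g give the
    identity for N, conjugated by [B g] and scaled by [r^2]. Summed over g, the latter is [r^2 Z]
    minus the new remainder term. *)
Lemma poisson_sum N : \sum_(a <- words n N)
    r ^+ (size a).*2 *: ((wordmx a)^t* *m (defect *m defect^t*) *m wordmx a) =
  1%:M - r ^+ N.*2 *: remainder N.
Proof.
rewrite defect_sqr; elim: N => [|N IH].
  by rewrite big_nil expr0 scale1r subrr.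
rewrite big_words /= expr0 scale1r trmxC1 mul1mx mulmx1.
have exp2 k : r ^+ k.+1.*2 = r ^+ 2 * r ^+ k.*2 by exact: (exprD r 2 k.*2).
have step g a : r ^+ (size a).+1.*2 *: ((wordmx a *m B g)^t* *m
      (1%:M - r ^+ 2 *: Z) *m (wordmx a *m B g)) =
    r ^+ 2 *: ((B g)^t* *m (r ^+ (size a).*2 *:
      ((wordmx a)^t* *m (1%:M - r ^+ 2 *: Z) *m wordmx a)) *m B g).
  rewrite exp2 trmxC_mul.
  by rewrite -!scalemxAr -scalemxAl scalerA !mulmxA.
under eq_bigr do under eq_bigr do rewrite step.
under eq_bigr do rewrite -scaler_sumr -mulmx_suml -mulmx_sumr IH.
rewrite exp2 -scalerA -scaler_sumr [X in _ + _ *: X](eq_bigr (fun g => (B g)^t* *m B g -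
  r ^+ N.*2 *: ((B g)^t* *m remainder N *m B g))) => [|g _]; last first.
  by rewrite mulmxBr mulmxBl mulmx1 -scalemxAr -scalemxAl.
by rewrite sumrB -scaler_sumr scalerBr addrA subrK.
Qed.

Definition sqform (M : 'M[C]_L) (u : 'rV[C]_L) := (u *m M *m u^t*) 0 0.

Lemma sqform1_ge0 u : 0 <= sqform 1%:M u.
Proof.
rewrite /sqform mulmx1 mulmx_trmxCE sumr_ge0// => k _.
by rewrite -normCK exprn_ge0.
Qed.

Lemma sqformZ_le u : sqform Z u <= sqform 1%:M u.
Proof.
rewrite -subr_ge0; have := sqform1_ge0 (u *m (1%:M - Z)).
have PP : (1%:M - Z) *m (1%:M - Z) = 1%:M - Z.
  by rewrite mulmxBr mulmx1 mulmxBl mul1mx ZZ subrr subr0.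
rewrite /sqform trmxC_mul trmxCB trmxC1 Z_herm mulmx1.
rewrite mulmxA -[_ *m _ *m (1%:M - Z)]mulmxA PP mulmxBr mulmx1 mulmxBl.
have mxB (M1 M2 : 'M[C]_1) : (M1 - M2) 0 0 = M1 0 0 - M2 0 0 by rewrite !mxE.
by rewrite mxB.
Qed.

(** Conjugating [0 <= remainder N <= 1] by the [B g] and summing gives [0 <= remainder N.+1 <= Z],
    and the projection Z is at most 1. *)
Lemma remainder_bounds N u : 0 <= sqform (remainder N) u <= sqform 1%:M u.
Proof.
elim: N u => [|N IH] u /=; first by rewrite sqform1_ge0 lexx.
have E M : sqform (\sum_g (B g)^t* *m M *m B g) u =
    \sum_g sqform M (u *m (B g)^t*).
  rewrite /sqform mulmx_sumr mulmx_suml summxE; apply: eq_bigr => g _.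
  by rewrite trmxC_mul trmxCK !mulmxA.
rewrite E sumr_ge0/= => [|g _]; last by have /andP[] := IH (u *m (B g)^t*).
apply: le_trans (sqformZ_le u).
rewrite [Z](_ : _ = \sum_g (B g)^t* *m 1%:M *m B g).
  by rewrite E ler_sum// => g _; have /andP[] := IH (u *m (B g)^t*).
by apply: eq_bigr => g _; rewrite mulmx1.
Qed.

Lemma remainder_herm N : (remainder N)^t* = remainder N.
Proof.
elim: N => [|N IH] /=; first exact: trmxC1.
rewrite linear_sum/= raddf_sum/=; apply: eq_bigr => g _.
by rewrite !trmxC_mul trmxCK IH mulmxA.
Qed.

Lemma remainder_entry_bound N (u v : 'rV[C]_L) :
  `|(u *m remainder N *m v^t*) 0 0| *+ 2 <= sqform 1%:M u + sqform 1%:M v.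
Proof.
set M := remainder N; set x := (u *m M *m v^t*) 0 0.
(* The phase c turns both cross terms of the form at [u + c *: v] into [- |x|]; nonnegativity of
   that form then gives the bound. *)
have [c c1 cx] : exists2 c : C, `|c| = 1 & c^* * x = - `|x|.
  have [->|x0] := eqVneq x 0; first by exists 1; rewrite ?normr1// normr0 mulr0 oppr0.
  exists (- (x / `|x|)).
    by rewrite normrN normf_div normr_id divff// normr_eq0.
  rewrite rmorphN rmorphM/= fmorphV/= (conj_Creal (normr_real x)) mulNr.
  rewrite mulrAC [x^* * x]mulrC -normCK expr2 mulfK// normr_eq0//.
have xc : (v *m M *m u^t*) 0 0 = x^*.
  have -> : v *m M *m u^t* = (u *m M *m v^t*)^t*.
    by rewrite !trmxC_mul trmxCK remainder_herm mulmxA.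
  have mxC (Y : 'M[C]_1) : (Y^t*) 0 0 = (Y 0 0)^* by rewrite !mxE.
  exact: mxC.
have /andP[+ _] := remainder_bounds N (u + c *: v).
have -> : sqform M (u + c *: v) = sqform M u + sqform M v - `|x| *+ 2.
  have mxD (M1 M2 : 'M[C]_1) : (M1 + M2) 0 0 = M1 0 0 + M2 0 0 by rewrite !mxE.
  have mxZ a (M1 : 'M[C]_1) : (a *: M1) 0 0 = a * M1 0 0 by rewrite !mxE.
  rewrite /sqform trmxCD trmxCZ !mulmxDl !mulmxDr -!scalemxAr -!scalemxAl.
  rewrite scalerA !mxD !mxZ [c^* * c]mulrC -normCK c1 expr1n mul1r xc -/x.
  have -> : c * x^* = - `|x|.
    by rewrite -[c]conjCK -rmorphM cx rmorphN/= conj_Creal ?normr_real.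
  rewrite cx mulr2n; set a := (u *m M *m u^t*) 0 0; set b := (v *m M *m v^t*) 0 0.
  by ring.
rewrite subr_ge0 => /le_trans; apply; apply: lerD.
  by have /andP[] := remainder_bounds N u.
by have /andP[] := remainder_bounds N v.
Qed.

Definition poisson_vec (u : 'rV[C]_L) (a : seq 'I_n) : 'rV[C]_L :=
  r ^+ size a *: (u *m (wordmx a)^t* *m defect).

(* The left-hand side is [<(S_c (x) I) P u, P v>], cut off at length N, for the
   Poisson kernel [P u = sum_a e_a (x) poisson_vec u a]. *)
Lemma poisson_vec_shift (u v : 'rV[C]_L) (c : seq 'I_n) N :
  \sum_(a <- words n N) (poisson_vec u a *m (poisson_vec v (c ++ a))^t*) 0 0 =
  r ^+ size c * ((u *m wordmx c *m v^t*) 0 0 -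
    r ^+ N.*2 * (u *m remainder N *m (v *m (wordmx c)^t*)^t*) 0 0).
Proof.
have mxB (M1 M2 : 'M[C]_1) : (M1 - M2) 0 0 = M1 0 0 - M2 0 0 by rewrite !mxE.
have mxZ a (M1 : 'M[C]_1) : (a *: M1) 0 0 = a * M1 0 0 by rewrite !mxE.
have step a : poisson_vec u a *m (poisson_vec v (c ++ a))^t* =
    r ^+ size c *: (u *m (r ^+ (size a).*2 *:
      ((wordmx a)^t* *m (defect *m defect^t*) *m wordmx a)) *m
      (wordmx c *m v^t*)).
  rewrite /poisson_vec trmxCZ -!scalemxAl -!scalemxAr -!scalemxAl !scalerA.
  rewrite conj_Creal ?ger0_real ?exprn_ge0// size_cat wordmx_cat.
  rewrite !trmxC_mul !trmxCK !mulmxA; congr (_ *: _).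
  by rewrite -!exprD addnC -addnn addnA.
rewrite -summxE (eq_bigr _ (fun a _ => step a)) -scaler_sumr -mulmx_suml.
rewrite -mulmx_sumr poisson_sum mxZ; congr (_ * _).
rewrite trmxC_mul trmxCK mulmxBr mulmxBl mulmx1 mxB -scalemxAr -scalemxAl mxZ.
by rewrite [u *m (_ *m _)]mulmxA.
Qed.

End Poisson.

(** * Realization of a shift-invariant positive kernel by partial isometries *)

Section Kernel.
Local Open Scope sesquilinear_scope.
Context {C : numClosedFieldType} (n m d : nat).
Variable k : seq 'I_n -> 'I_m -> seq 'I_n -> 'I_m -> C.
Hypothesis kC : forall a j b i, k a j b i = (k b i a j)^*.
Hypothesis k_ge0 : forall f : seq 'I_n -> 'I_m -> C,
  0 <= \sum_(a <- words n d.+1) \sum_j \sum_(b <- words n d.+1) \sum_i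
         f a j * k a j b i * (f b i)^*.
Hypothesis k_shift : forall g a j h b i,
  k (g :: a) j (h :: b) i = if g == h then k a j b i else 0.

Let W := words n d.+1.
Let J := ('I_(size W) * 'I_m)%type.
Let wd (p : 'I_#|{: J}|) := nth [::] W (enum_val p).1.

Lemma big_words_index (V : nmodType) (F : seq 'I_n -> 'I_m -> V) :
  \sum_(a <- W) \sum_j F a j = \sum_(p < #|{: J}|) F (wd p) (enum_val p).2.
Proof.
rewrite (big_nth [::]) big_mkord pair_big/=.
rewrite -[RHS](big_enum_val (fun x : J => F (nth [::] W x.1) x.2)).
by apply: eq_bigl.
Qed.

Lemma kernel_vectors : exists L (xi : seq 'I_n -> 'I_m -> 'rV[C]_L),
  forall a j b i, a \in W -> b \in W -> (xi a j *m (xi b i)^t*) 0 0 = k a j b i.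
Proof.
pose K := \matrix_(p, q) k (wd p) (enum_val p).2 (wd q) (enum_val q).2.
have [||G GK] := @gram_factor _ _ K.
- by apply/matrixP => p q; rewrite !mxE -kC.
(* The words of W are distinct, so each sum defining f has at most one term: f is u read as a
   function of words and indices. *)
- move=> u; pose f a j := \sum_(p | (wd p == a) && ((enum_val p).2 == j)) u 0 p.
  have fE p : f (wd p) (enum_val p).2 = u 0 p.
    rewrite /f (big_pred1 p)// => q /=; apply/idP/eqP => [|->]; last by rewrite !eqxx.
    case/andP; rewrite /wd nth_uniq ?words_uniq// => /eqP/val_inj e1 /eqP e2.
    by apply: enum_val_inj; rewrite [LHS]surjective_pairing e1 e2 -surjective_pairing.
  suff -> : (u *m K *m u^t*) 0 0 = \sum_(a <- W) \sum_j \sum_(b <- W) \sum_i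
         f a j * k a j b i * (f b i)^* by exact: k_ge0.
  rewrite big_words_index -mulmxA mxE; apply: eq_bigr => p _.
  rewrite big_words_index mxE mulr_sumr; apply: eq_bigr => q _.
  by rewrite !mxE !fE mulrA.
pose ix a (j : 'I_m) : option 'I_#|{: J}| :=
  omap (fun s : 'I_(size W) => enum_rank (s, j)) (insub (index a W)).
exists #|{: J}|, (fun a j => if ix a j is Some p then row p G else 0).
move=> a j b i aW bW.
have ixW c l : c \in W -> exists2 p, ix c l = Some p & wd p = c /\ (enum_val p).2 = l.
  rewrite -index_mem => cW; exists (enum_rank (Ordinal cW, l)).
    by rewrite /ix insubT.
  by rewrite /wd enum_rankK/= nth_index// -index_mem.
have [p -> [pa pj]] := ixW a j aW; have [q -> [qb qi]] := ixW b i bW.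
rewrite mulmx_trmxCE; have := congr1 (fun M : 'M[C]_#|{: J}| => M p q) GK.
rewrite mulmx_trmxCE mxE pa pj qb qi => <-.
by apply: eq_bigr => l _; rewrite !mxE.
Qed.

(** By [k_shift], the maps sending [xi a j] to [xi (g :: a) j] preserve inner products and have
    orthogonal ranges for distinct g. They are prescribed only for words a of length less than d, so
    that [g :: a] still lies in W. *)
Lemma kernel_isometries : exists L (xi : 'I_m -> 'rV[C]_L) (B : 'I_n -> 'M[C]_L),
  let Z := \sum_g (B g)^t* *m B g in Z *m Z = Z /\
  forall a j i, (size a <= d)%N ->
    (xi j *m wordmx B a *m (xi i)^t*) 0 0 = k a j [::] i.
Proof.
have [L [xi xik]] := kernel_vectors.
pose W' := words n d; pose J' := ('I_(size W') * 'I_m)%type.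
pose wd' (p : 'I_#|{: J'}|) := nth [::] W' (enum_val p).1.
have wd'W p : wd' p \in W' by exact: mem_nth.
have W'W p : wd' p \in W.
  by have := wd'W p; rewrite !mem_words => /leqW.
have gW'W g p : g :: wd' p \in W by have := wd'W p; rewrite !mem_words.
pose M : 'M[C]_(#|{: J'}|, L) := \matrix_p xi (wd' p) (enum_val p).2.
pose G g : 'M[C]_(#|{: J'}|, L) := \matrix_p xi (g :: wd' p) (enum_val p).2.
have [|B [MB ZZ]] := @gram_isometries _ _ _ _ M G.
  move=> g h; apply/matrixP => p q.
  have rowM (X Y : 'M[C]_(#|{: J'}|, L)) :
      (X *m Y^t*) p q = (row p X *m (row q Y)^t*) 0 0.
    by rewrite !mulmx_trmxCE; apply: eq_bigr => l _; rewrite !mxE.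
  rewrite rowM !rowK xik// k_shift.
  by case: eqP => _; [rewrite rowM !rowK xik|rewrite mxE].
have xiB g a j : a \in W' -> xi a j *m B g = xi (g :: a) j.
  move=> aW'; have aW := aW'; rewrite -index_mem in aW.
  pose p := enum_rank ((Ordinal aW, j) : J').
  have pa : wd' p = a by rewrite /wd' enum_rankK/= nth_index.
  have pj : (enum_val p).2 = j by rewrite enum_rankK.
  have := congr1 (row p) (MB g).
  by rewrite row_mul !rowK pa pj.
exists L, (xi [::]), B; split=> // a j i ad.
have -> : xi [::] j *m wordmx B a = xi a j; last by rewrite xik// mem_words.
elim: a ad => [|g a IH] /= ad; first by rewrite mulmx1.
by rewrite mulmxA IH ?(ltnW ad)// xiB// mem_words.
Qed.

End Kernel.

(** * Limits of nonnegative complex numbers *)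

Section ComplexParts.
Context {R : realType}.
Implicit Types z w : R[i].

Lemma ReD z w : complex.Re (z + w) = complex.Re z + complex.Re w.
Proof. by case: z w => [? ?] []. Qed.

Lemma ReN z : complex.Re (- z) = - complex.Re z.
Proof. by case: z. Qed.

Lemma ReZ (t : R) z : complex.Re (t%:C * z) = t * complex.Re z.
Proof. by case: z => a b /=; rewrite mul0r subr0. Qed.

Lemma Re_conj z : complex.Re z^* = complex.Re z.
Proof. by case: z. Qed.

Lemma Re_le_norm z : complex.Re z <= complex.Re `|z|.
Proof.
rewrite -lecR (RRe_real (normr_real _)); apply: le_trans (normc_ge_Re z).
by rewrite lecR ler_norm.
Qed.

Lemma Re_norm_ge0 (V : normedZmodType R[i]) (v : V) : 0 <= complex.Re `|v|.
Proof. by rewrite -ler0c (RRe_real (normr_real _)). Qed.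

(* The order of [R[i]] compares only numbers with equal imaginary parts, so a
   limit of nonnegative numbers is controlled part by part. *)
Lemma complex_ge0_approx z (K : R[i]) :
  (forall t : R, 0 < t -> t < 1 -> exists2 w, 0 <= w & `|z - w| <= t%:C * K) ->
  0 <= z.
Proof.
move=> zw; have bnd (t : R) : 0 < t -> t < 1 ->
    - (t * complex.Re K) <= complex.Re z /\ `|complex.Im z| <= t * complex.Re K.
  move=> t0 t1; have [w w0 zwK] := zw t t0 t1.
  have /andP[/eqP wi wr] : (complex.Im w == 0) && (0 <= complex.Re w).
    by move: w0; rewrite lecE.
  have K' : complex.Re `|z - w| <= t * complex.Re K.
    by move: zwK; rewrite lecE ReZ => /andP[].
  split.
    have := le_trans (Re_le_norm (w - z)) _; rewrite distrC => /(_ _ K').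
    by rewrite ReD ReN; lra.
  apply: le_trans K'; rewrite -[complex.Im z]subr0 -wi.
  have -> : complex.Im z - complex.Im w = complex.Im (z - w).
    by case: (z) (w) => ? ? [].
  by rewrite normc_def/= -sqrtr_sqr ler_wsqrtr// lerDr sqr_ge0.
(* If x is positive, then [t = 1 / 2] shows that [Re K] is positive, and any t below [x / Re K]
   contradicts the bound. *)
have squeeze (x : R) : (forall t, 0 < t -> t < 1 -> x <= t * complex.Re K) -> x <= 0.
  move=> xK; rewrite leNgt; apply/negP => x0.
  have K0 : 0 < complex.Re K.
    have := xK (1 / 2) ltac:(lra) ltac:(lra); lra.
  have [xlt|xge] := ltP x (complex.Re K).
    have := xK (x / (2 * complex.Re K)).
    have -> : x / (2 * complex.Re K) * complex.Re K = x / 2.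
      by field; rewrite gt_eqF.
    have -> : 0 < x / (2 * complex.Re K) by rewrite divr_gt0// mulr_gt0.
    have -> : x / (2 * complex.Re K) < 1 by rewrite ltr_pdivrMr ?mulr_gt0//; lra.
    by move=> /(_ erefl erefl); lra.
  have := xK (1 / 2) ltac:(lra) ltac:(lra); lra.
rewrite lecE; apply/andP; split.
  rewrite -normr_eq0 eq_le normr_ge0 andbT/=.
  by apply: squeeze => t t0 t1; have [] := bnd t t0 t1.
rewrite -oppr_le0; apply: squeeze => t t0 t1; have [] := bnd t t0 t1; lra.
Qed.

End ComplexParts.

(** * The Riesz representation theorem and adjoints *)

Section Riesz.
Context {R : realType} {H : hilbertType R}.
Implicit Types x y z : H.

Definition sqn x : R := complex.Re '[x, x].

Lemma dot_sqn x : '[x, x] = (sqn x)%:C.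
Proof. by rewrite RRe_real// ger0_real// dnorm_ge0. Qed.

Lemma norm_sqn x : `|x| ^+ 2 = (sqn x)%:C.
Proof. by rewrite -hdotxx dot_sqn. Qed.

Lemma sqn_ge0 x : 0 <= sqn x.
Proof. by rewrite -ler0c -dot_sqn dnorm_ge0. Qed.

Lemma dotC x y : '[x, y] = ('[y, x])^*.
Proof. by rewrite hermC expr0 mul1r. Qed.

Lemma sqnD x y : sqn (x + y) = sqn x + sqn y + 2 * complex.Re '[x, y].
Proof. by rewrite /sqn dnormD !ReD Re_conj; lra. Qed.

Lemma sqnZ (t : R) x : sqn (t%:C *: x) = t ^+ 2 * sqn x.
Proof.
rewrite /sqn dnormZ -ReZ; congr (complex.Re (_ * _)).
by rewrite nrm2E /nrm2 /= expr0n addr0.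
Qed.

Lemma sqnN x : sqn (- x) = sqn x.
Proof. by rewrite /sqn -[- x]scaleN1r dnormZ normrN1 expr1n mul1r. Qed.

Lemma dot_CS x y : `|'[x, y]| <= `|x| * `|y|.
Proof.
rewrite -ler_sqr ?nnegrE ?mulr_ge0// exprMn -!hdotxx.
exact: (@dot_CauchySchwarz _ _ hdot).
Qed.

Section Functional.
Variables (f : H -> R[i]) (M : R).
Hypotheses (f_linear : forall a x y, f (a *: x + y) = a * f x + f y)
  (f_bound : forall x, `|f x| <= M%:C * `|x|).

(** If y represents f, this is [|x - y|^2 - |y|^2], so the representing vector is the minimizer of
    J. *)
Let J x : R := sqn x - 2 * complex.Re (f x).

Let fD x y : f (x + y) = f x + f y.
Proof. by have := f_linear 1 x y; rewrite scale1r mul1r. Qed.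

Let f0 : f 0 = 0.
Proof.
by have := f_linear 1 0 0; rewrite scaler0 addr0 mul1r -{1}[f 0]addr0 => /addrI.
Qed.

Let fZ a x : f (a *: x) = a * f x.
Proof. by have := f_linear a x 0; rewrite addr0 f0 addr0. Qed.

Let J_lb x : - M ^+ 2 <= J x.
Proof.
have h : 2 * complex.Re (f x) <= M ^+ 2 + sqn x.
  apply: (@le_trans _ _ (2 * complex.Re `|f x|)).
    by rewrite ler_pM2l// Re_le_norm.
  have nx : `|x| = (complex.Re `|x|)%:C by rewrite (RRe_real (normr_real _)).
  have := f_bound x; rewrite nx -rmorphM -(RRe_real (normr_real (f x))) lecR.
  have -> : sqn x = complex.Re `|x| ^+ 2.
    by apply: complexI; rewrite -norm_sqn nx -rmorphXn.
  move: (complex.Re `|f x|) (complex.Re `|x|) => a b ab.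
  have : 0 <= (M - b) ^+ 2 by exact: sqr_ge0.
  by rewrite sqrrB; nra.
by rewrite /J; lra.
Qed.

(* Minimizing sequences of [J] are Cauchy by the parallelogram law, and their
   limit represents [f]. *)
Lemma riesz : exists y, forall x, f x = '[x, y].
Proof.
pose m := inf (range J).
have hi : has_inf (range J).
  by split; [exists (J 0), 0|exists (- M ^+ 2) => _ [x _ <-]].
have mJ x : m <= J x by apply: ge_inf; [exact: hi.2|exists x].
have /choice[u um] (k : nat) : exists x, J x < m + k.+1%:R^-1.
  have [//|_ [x _ <-] xk] := @inf_adherent _ _ k.+1%:R^-1 _ hi; last by exists x.
have par x y : sqn (x - y) = 2 * J x + 2 * J y - 4 * J ((1 / 2)%:C *: (x + y)).
  rewrite /J sqnZ !sqnD sqnN fZ fD ReZ ReD.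
  have -> : '[x, - y] = - '[x, y] by rewrite linearNr.
  by rewrite ReN; lra.
have ucauchy : cauchy (u k @[k --> \oo]).
  apply/cauchy_ballP => e e0.
  have er : (complex.Re e)%:C = e by apply: RRe_real; rewrite gtr0_real.
  have er0 : 0 < complex.Re e by rewrite -ltcR er.
  (* Two points at which J exceeds its infimum by less than [e^2 / 4] are at distance less than e,
     by [par]. *)
  have d0 : 0 < complex.Re e ^+ 2 / 4 by rewrite divr_gt0// exprn_gt0.
  have [N _ hN] := near_infty_natSinv_lt (PosNum d0).
  exists ([set u k | k in [set k | (N <= k)%N]], [set u k | k in [set k | (N <= k)%N]]).
    by split; exists N => // k /= Nk; exists k.
  move=> [_ _] /= [[k Nk <-] [l Nl <-]]; rewrite -ball_normE/= -er.
  rewrite -ltr_sqr ?nnegrE ?normr_ge0 ?ler0c ?(ltW er0)// norm_sqn -rmorphXn ltcR par.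
  have /= := hN _ Nk; have /= := hN _ Nl; have := um k; have := um l.
  have := mJ ((1 / 2)%:C *: (u k + u l)); move: (J _) (J _) (J _) => a b c.
  move: (_^-1) (_^-1) (_ ^+ 2) => p q t. lra.
have /cvg_ex[y uy] : cvg (u k @[k --> \oo]) by exact: cauchy_cvg.
have Reyz z : complex.Re (f z) = complex.Re '[y, z].
  have zn : `|z| = (complex.Re `|z|)%:C by rewrite (RRe_real (normr_real _)).
  set c := complex.Re '[y, z] - complex.Re (f z).
  (* First variation: for k large, [J (u k)] is within [h^2] of the infimum, and comparing with J at
     [u k + h z] and [u k - h z] gives [2 |ck| <= h (1 + |z|^2)]. Replacing [u k] by its limit costs
     at most h. *)
  have bnd (h : R) : 0 < h -> `|c| <= h * (3 + sqn z).
    move=> h0; pose h' : R := h / (1 + complex.Re `|z|).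
    have z1 : 0 < 1 + complex.Re `|z| by have := Re_norm_ge0 z; lra.
    have h'0 : 0 < h'%:C by rewrite ltcR divr_gt0.
    move/cvgrPdist_le: uy => /(_ _ h'0)[N1 _ hN1].
    have [N2 _ hN2] := near_infty_natSinv_lt (PosNum (exprn_gt0 2 h0)).
    pose k := maxn N1 N2; have /= uk := hN1 k (leq_maxl _ _).
    have /= hk := hN2 k (leq_maxr _ _).
    pose ck := complex.Re '[u k, z] - complex.Re (f z).
    have cck : `|c - ck| <= h.
      have -> : c - ck = complex.Re '[y - u k, z].
        by rewrite /c /ck linearBl ReD ReN; lra.
      rewrite -lecR; apply: le_trans (normc_ge_Re _) _.
      apply: le_trans (dot_CS _ _) _.
      apply: le_trans (ler_wpM2r (normr_ge0 z) uk) _.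
      rewrite zn -rmorphM lecR /h' mulrAC ler_pdivrMr//.
      by rewrite ler_pM2l//; lra.
    have Jt (t : R) : J (u k + t%:C *: z) = J (u k) + 2 * t * ck + t ^+ 2 * sqn z.
      rewrite /J sqnD sqnZ fD fZ ReD ReZ.
      have -> : '[u k, t%:C *: z] = t%:C * '[u k, z].
        by rewrite linearZr_LR/= conj_Creal// complex_real.
      by rewrite ReZ /ck; lra.
    have := mJ (u k + h%:C *: z); have := mJ (u k + (- h)%:C *: z).
    rewrite !Jt sqrrN; have := um k; have s0 := sqn_ge0 z.
    move: cck; rewrite !ler_norml => /andP[c1 c2].
    have hk' : k.+1%:R^-1 < h ^+ 2 := hk.
    clearbody ck c; move: (J (u k)) (k.+1%:R^-1) hk' => Jk q hq k1 k2 k3.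
    have k2' : 2 * ck <= h * (1 + sqn z).
      by rewrite -(ler_pM2l h0); lra.
    have k3' : - (h * (1 + sqn z)) <= 2 * ck.
      by rewrite -(ler_pM2l h0); lra.
    have hs : 0 <= h * sqn z by rewrite mulr_ge0// ltW.
    by apply/andP; split; lra.
  apply/eqP; rewrite eq_sym -subr_eq0 -/c; apply: contrapT => /negP c0.
  have s3 : 0 < 3 + sqn z by have := sqn_ge0 z; lra.
  (* For this h the bound reads [|c| <= |c| / 2]. *)
  have := bnd (`|c| / (3 + sqn z) / 2).
  rewrite !divr_gt0// ?normr_gt0// => /(_ isT).
  have -> : `|c| / (3 + sqn z) / 2 * (3 + sqn z) = `|c| / 2.
    by field; rewrite gt_eqF.
  have : 0 < `|c| by rewrite normr_gt0.
  by lra.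
(* The imaginary parts agree by the identity of real parts at [i x]. *)
exists y => x; rewrite dotC; have := Reyz x.
have := Reyz ('i%C *: x); rewrite fZ linearZr_LR/=.
have -> : ('i%C : R[i])^* = - 'i%C by simpc.
case: (f x) '[y, x] => [a b] [c d] /= ? ?; apply/eqP.
by rewrite eq_complex /=; apply/andP; split; apply/eqP; lra.
Qed.
End Functional.
End Riesz.

Section Adjoints.
Context {R : realType}.

Definition adjointable (H K : hilbertType R) (A : H -> K) :=
  exists B : K -> H, is_adjoint A B.

Lemma adjointP (H K : hilbertType R) (A : H -> K) :
  adjointable A -> is_adjoint A (adjoint A).
Proof. by move=> [B AB]; rewrite /adjoint; case: xgetP => // /(_ B). Qed.

Lemma adjointable_bounded (H K : hilbertType R) (A : H -> K) (M : R) :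
  (forall a x y, A (a *: x + y) = a *: A x + A y) ->
  (forall x, `|A x| <= M%:C * `|x|) -> adjointable A.
Proof.
move=> Alin AM.
have /choice[B AB] (y : K) : exists z, forall x, '[A x, y] = '[x, z].
  apply: (@riesz _ _ (fun x => '[A x, y]) (M * complex.Re `|y|)).
    by move=> a x z; rewrite Alin linearPl.
  move=> x; apply: le_trans (dot_CS _ _) _.
  rewrite rmorphM/= (RRe_real (normr_real _)) mulrAC.
  by rewrite ler_wpM2r.
by exists B => x y.
Qed.

Lemma continuous_bounded (H K : hilbertType R) (A : {linear H -> K}) :
  continuous A -> exists M : R, forall x, `|A x| <= M%:C * `|x|.
Proof.
move=> /linear_bounded_continuous/linear_boundedP[M [Mr AM]].
exists (complex.Re (M + 1)) => x; rewrite RRe_real ?rpredD ?rpred1//.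
by apply: AM; rewrite ltrDl.
Qed.

Lemma adjointable_continuous (H K : hilbertType R) (A : {linear H -> K}) :
  continuous A -> adjointable A.
Proof.
move=> /continuous_bounded[M AM]; apply: adjointable_bounded AM => a x y.
exact: linearP.
Qed.

Section Words.
Context (H : hilbertType R) (n : nat) (T : 'I_n -> H -> H).
Hypothesis T_adj : forall i, adjointable (T i).

Lemma adjointable_wordop a : adjointable (wordop T a).
Proof.
elim: a => [|i a [B AB]] /=; first by exists id.
by have [B' AB'] := T_adj i; exists (B \o B') => x y /=; rewrite AB' AB.
Qed.

Lemma dot_polyop (p : ncpoly R n) x y :
  '[polyop T p x, y] = \sum_(c <- finsupp p) p c * '[wordop T c x, y].
Proof.
by rewrite linear_sumlz; apply: eq_bigr => c _; rewrite linearZl_LR.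
Qed.

Lemma adjointable_polyop (p : ncpoly R n) : adjointable (polyop T p).
Proof.
have /choice[B AB] c := adjointable_wordop c.
exists (fun y => \sum_(c <- finsupp p) (p c)^* *: B c y) => x y.
apply: (etrans (dot_polyop _ _ _)); rewrite linear_sumr; apply: eq_bigr => c _.
by rewrite linearZr_LR/= conjCK AB.
Qed.

Lemma dot_op (p q : ncpoly R n) x y :
  '[(polyop T p \+ adjoint (polyop T q)) x, y] =
  \sum_(c <- finsupp p) p c * '[wordop T c x, y] +
  (\sum_(c <- finsupp q) q c * '[wordop T c y, x])^*.
Proof.
rewrite /= linearDl; congr (_ + _); first exact: dot_polyop.
apply: (etrans (dotC _ _)); congr (_^*).
exact: etrans (esym (adjointP (adjointable_polyop q) _ _)) (dot_polyop _ _ _).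
Qed.

End Words.
End Adjoints.

(** * Finitely supported vectors of the Fock space *)

Section FiniteSums.
Context {R : realType} {I : choiceType}.

Lemma has_sum_finite (f : I -> R[i]) (s : seq I) : uniq s ->
  (forall i, i \notin s -> f i = 0) -> has_sum f (\sum_(i <- s) f i).
Proof.
move=> us fs; apply: cvg_near_cst.
exists [fset i in s]%fset => // A /= sA; rewrite partial_sumE.
rewrite (bigID (mem s))/= [X in _ + X]big1 ?addr0 => [|i /fs//].
rewrite -big_filter; apply: perm_big; apply: uniq_perm => //.
  by rewrite filter_uniq.
move=> i; rewrite mem_filter; apply: andb_idr => si.
by apply: (fsubsetP sA); rewrite inE.
Qed.

Lemma usum_finite (f : I -> R[i]) (s : seq I) : uniq s ->
  (forall i, i \notin s -> f i = 0) -> usum f = \sum_(i <- s) f i.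
Proof. by move=> us fs; apply/has_sum_usum/has_sum_finite. Qed.

Lemma basis_subproof (a : I) : (fun b => (b == a)%:R) \in @ell2_pred R I.
Proof.
apply/asboolP; eexists; apply: (@has_sum_finite _ [:: a]) => // b.
by rewrite inE => /negPf ->; rewrite normr0 expr0n.
Qed.

Definition basis (a : I) : ell2 R I := Ell2 (basis_subproof a).

Lemma dot_basis a (x : ell2 R I) : '[basis a, x] = (x a)^*.
Proof.
rewrite -[LHS]/(ell2_dot _ _) /ell2_dot (@usum_finite _ [:: a])//.
  by rewrite big_seq1 /= eqxx mul1r.
by move=> b; rewrite inE /= => /negPf->; rewrite mul0r.
Qed.

End FiniteSums.

Section Creation.
Context {R : realType} {n : nat}.
Implicit Types (x y : fock R n).

Lemma creation_linear i a x y :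
  creation i (a *: x + y) = a *: creation i x + creation i y.
Proof.
apply/val_inj/funext => b.
rewrite -[RHS]/(a * creation_coef i x b + creation_coef i y b) /=.
by case: b => [|j b] /=; [|case: eqP => _ //]; rewrite mulr0 addr0.
Qed.

Lemma creation_basis i a : creation i (basis a) = basis (i :: a) :> fock R n.
Proof.
apply/val_inj/funext => -[|j b] //=; rewrite eqseq_cons; by case: eqP.
Qed.

(** A finite set B containing [i :: a] for all a in A has the same partial sum as the set of tails
    of its words starting with i, and that set contains A. This reindexing makes the creation
    operators isometric. *)
Lemma has_sum_cons (f : seq 'I_n -> R[i]) i s :
  (forall a, ohead a != Some i -> f a = 0) ->
  has_sum (fun a => f (i :: a)) s -> has_sum f s.
Proof.
move=> f0 /cvgrPdist_le fs; apply/cvgrPdist_le => e /fs[A _ Ae].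
exists [fset i :: a | a in A]%fset => // B /= AB.
pose t := [seq behead a | a <- B & ohead a == Some i].
have ut : uniq t.
  rewrite map_inj_in_uniq; first by rewrite filter_uniq// fset_uniq.
  move=> [|j a] [|k b]; rewrite !mem_filter//= !(inj_eq Some_inj).
  by move=> /andP[/eqP-> _] /andP[/eqP-> _] ->.
have -> : summability.partial_sum f B =
    summability.partial_sum (fun a => f (i :: a)) [fset a in t]%fset.
  rewrite !partial_sumE (bigID [pred a | ohead a == Some i])/=.
  rewrite [X in _ + X]big1 ?addr0 => [|a]; last exact: f0.
  rewrite [RHS](perm_big t); last first.
    by apply: uniq_perm => // [|a]; rewrite ?fset_uniq// in_fset.
  rewrite big_map big_filter; apply: eq_bigr => -[|j a] //=.
  by rewrite (inj_eq Some_inj) => /eqP ->.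
apply: Ae => /=; apply/fsubsetP => a aA; rewrite in_fset.
apply/mapP; exists (i :: a) => //; rewrite mem_filter/= eqxx/=.
by apply: (fsubsetP AB); apply: in_imfset.
Qed.

Lemma creation_dot i j x y :
  '[creation i x, creation j y] = if i == j then '[x, y] else 0.
Proof.
rewrite -[LHS]/(ell2_dot _ _) /ell2_dot; case: eqP => [<-|ij].
  apply/has_sum_usum/(@has_sum_cons _ i).
    move=> [|k a] /=; first by rewrite mul0r.
    by rewrite (inj_eq Some_inj) => /negPf ->; rewrite mul0r.
  by rewrite /= eqxx; exact: ell2_dotP.
rewrite (@usum_finite _ _ _ [::]) ?big_nil// => -[|k a] _ /=; first by rewrite mul0r.
case: eqP => [->|]; last by rewrite mul0r.
by case: eqP => // _; rewrite conjC0 mulr0.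
Qed.

Lemma adjointable_creation i : adjointable (creation i : fock R n -> fock R n).
Proof.
apply: (@adjointable_bounded _ _ _ _ 1); first exact: creation_linear.
move=> x; rewrite mul1r -ler_sqr ?nnegrE ?normr_ge0//.
by rewrite -!hdotxx creation_dot eqxx.
Qed.

Lemma wordop_creation_linear c a x y :
  wordop creation c (a *: x + y) =
  a *: wordop creation c x + wordop creation c y :> fock R n.
Proof. by elim: c => //= i c IH; rewrite IH creation_linear. Qed.

Lemma wordop_creation_basis c a :
  wordop creation c (basis a) = basis (c ++ a) :> fock R n.
Proof. by elim: c => //= i c IH; rewrite IH creation_basis. Qed.

End Creation.

Section FockVectors.
Context {R : realType} {n : nat}.
Implicit Types (f g : seq 'I_n -> R[i]).

Definition fvec N f : fock R n := \sum_(a <- words n N) f a *: basis a.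

Lemma wordop_fvec c N f :
  wordop creation c (fvec N f) = \sum_(a <- words n N) f a *: basis (c ++ a).
Proof.
rewrite /fvec; elim: (words n N) => [|a s IH].
  rewrite !big_nil; have := wordop_creation_linear c (-1) (0 : fock R n) 0.
  by rewrite scaleN1r addNr scaleN1r addNr.
by rewrite !big_cons wordop_creation_linear wordop_creation_basis IH.
Qed.

Lemma dot_basis_fvec b N f :
  '[basis b, fvec N f] = if b \in words n N then (f b)^* else 0.
Proof.
rewrite linear_sumr; under eq_bigr => a _.
  rewrite linearZr_LR/= dot_basis/= conjC_nat; over.
case: ifPn => bN.
  rewrite (bigD1_seq b)//=; last exact: words_uniq.
  rewrite eqxx mulr1 big1 ?addr0// => a ab.
  by rewrite eq_sym (negPf ab) mulr0.
rewrite big1_seq// => a /andP[_ aN]; case: eqP => [ba|]; last by rewrite mulr0.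
by rewrite ba aN in bN.
Qed.

(** Words [c ++ a] of length at least N lie outside the support of the second vector, which shortens
    the sum. *)
Lemma dot_wordop_fvec c N f g :
  '[wordop creation c (fvec N f), fvec N g] =
  \sum_(a <- words n (N - size c)) f a * (g (c ++ a))^*.
Proof.
rewrite wordop_fvec linear_sumlz.
rewrite (eq_bigr (fun a =>
  if c ++ a \in words n N then f a * (g (c ++ a))^* else 0)); last first.
  move=> a _; rewrite linearZl_LR.
  transitivity (f a * (if c ++ a \in words n N then (g (c ++ a))^* else 0)).
    congr (_ * _); exact: dot_basis_fvec.
  by case: ifP => _; rewrite ?mulr0.
rewrite -big_mkcond -big_filter /=.
rewrite (perm_big (words n (N - size c))); last first.
  apply: uniq_perm; rewrite ?filter_uniq ?words_uniq// => a.
  rewrite mem_filter mem_words_cat andb_idr// !mem_words => /leq_trans; apply.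
  exact: leq_subr.
by [].
Qed.

End FockVectors.

(** * Transfer of positivity from the Fock space to a kernel *)

Lemma bernoulli (R : realType) (s : R) c : 0 <= s <= 1 -> 1 - (1 - s) ^+ c <= c%:R * s.
Proof.
move=> /andP[s0 s1]; elim: c => [|c IH]; first by rewrite expr0 subrr mul0r.
have : (1 - s) ^+ c <= 1 by rewrite exprn_ile1; lra.
by rewrite exprS -natr1; nra.
Qed.

Section Pairing.
Local Open Scope sesquilinear_scope.
Context {R : realType} (n m : nat) (p q : 'I_m -> 'I_m -> ncpoly R n).
Implicit Types k : seq 'I_n -> 'I_m -> 'I_m -> R[i].

(** The quadratic form of the operator matrix with entries [p i j] plus the adjoint of [q i j],
    where [k c j i] stands for the inner product of the word c applied to the j-th vector with the
    i-th vector. *)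
Definition pairing k : R[i] := \sum_i \sum_j
  (\sum_(c <- finsupp (p i j)) p i j c * k c j i +
   (\sum_(c <- finsupp (q i j)) q i j c * k c i j)^*).

Definition pairing_bound k : R[i] := \sum_i \sum_j
  (\sum_(c <- finsupp (p i j)) `|p i j c| * k c j i +
   \sum_(c <- finsupp (q i j)) `|q i j c| * k c i j).

Lemma pairing_sum L (k : 'I_L -> seq 'I_n -> 'I_m -> 'I_m -> R[i]) :
  pairing (fun c j i => \sum_l k l c j i) = \sum_l pairing (k l).
Proof.
rewrite /pairing [RHS]exchange_big; apply: eq_bigr => i _.
rewrite [RHS]exchange_big; apply: eq_bigr => j _.
rewrite big_split -rmorph_sum/=; congr (_ + _^*); rewrite [RHS]exchange_big.
  by apply: eq_bigr => c _; rewrite mulr_sumr.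
by apply: eq_bigr => c _; rewrite mulr_sumr.
Qed.

Variable d : nat.
Hypothesis p_deg : forall i j c, c \in finsupp (p i j) -> (size c <= d)%N.
Hypothesis q_deg : forall i j c, c \in finsupp (q i j) -> (size c <= d)%N.

Lemma pairing_dist k k' b (t : R[i]) :
  (forall c j i, (size c <= d)%N -> `|k c j i - k' c j i| <= t * b c j i) ->
  `|pairing k - pairing k'| <= t * pairing_bound b.
Proof.
move=> kb; rewrite /pairing -sumrB /pairing_bound mulr_sumr.
apply: le_trans (ler_norm_sum _ _ _) _; apply: ler_sum => i _.
rewrite -sumrB mulr_sumr.
apply: le_trans (ler_norm_sum _ _ _) _; apply: ler_sum => j _.
rewrite opprD addrACA mulrDr; apply: le_trans (ler_normD _ _) _; apply: lerD.
  rewrite -sumrB mulr_sumr; apply: le_trans (ler_norm_sum _ _ _) _.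
  rewrite big_seq [leRHS]big_seq; apply: ler_sum => c cp; rewrite -mulrBr normrM mulrCA.
  by rewrite ler_wpM2l// kb// (p_deg cp).
rewrite -rmorphB norm_conjC -sumrB mulr_sumr.
apply: le_trans (ler_norm_sum _ _ _) _.
rewrite big_seq [leRHS]big_seq; apply: ler_sum => c cq; rewrite -mulrBr normrM mulrCA.
by rewrite ler_wpM2l// kb// (q_deg cq).
Qed.

Hypothesis pairing_fock_ge0 : forall y : 'I_m -> fock R n,
  0 <= pairing (fun c j i => '[wordop creation c (y j), y i]).

(* For 0 < r < 1 the kernel [r^|c| k c j [::] i] is, up to a remainder of order
   r^(2N), the one given by Poisson vectors cut off at length N: the hypothesis
   applies to each of their coordinates. *)
Lemma pairing_kernel_ge0 (k : seq 'I_n -> 'I_m -> seq 'I_n -> 'I_m -> R[i]) :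
  (forall a j b i, k a j b i = (k b i a j)^*) ->
  (forall f : seq 'I_n -> 'I_m -> R[i],
    0 <= \sum_(a <- words n d.+1) \sum_j \sum_(b <- words n d.+1) \sum_i
           f a j * k a j b i * (f b i)^*) ->
  (forall g a j h b i,
    k (g :: a) j (h :: b) i = if g == h then k a j b i else 0) ->
  0 <= pairing (fun c j i => k c j [::] i).
Proof.
move=> kC k0 ks; have [L [xi [B [ZZ xik]]]] := kernel_isometries kC k0 ks.
pose b c j i := `|k c j [::] i| + (sqform 1%:M (xi j) +
  sqform 1%:M (xi i *m (wordmx B c)^t*)).
apply: (@complex_ge0_approx _ _ (pairing_bound b)) => t t0 t1.
(* With [r = 1 - s], Bernoulli's inequality gives [1 - r^|c| <= t / 2] for all words c of length at
   most d. *)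
pose s := t / 2 / d.+1%:R; have s0 : 0 < s by rewrite !divr_gt0.
have sd : d.+1%:R * s = t / 2 by rewrite /s mulrC divfK// pnatr_eq0.
have s1 : s < 1.
  have : 1 * s <= d.+1%:R * s by rewrite ler_pM2r// ler1n.
  by rewrite sd; lra.
have [M rM] : exists M, (1 - s) ^+ M <= t / 2.
  have /cvgrPdist_le : (1 - s) ^+ k @[k --> \oo] --> (0 : R).
    by apply: cvg_expr; rewrite ger0_norm; lra.
  move=> /(_ (t / 2)) []; first by lra.
  move=> M _ /(_ M (leqnn _))/=; rewrite sub0r normrN => h; exists M.
  exact: le_trans (ler_norm _) h.
pose r : R[i] := (1 - s)%:C.
have r0 : 0 <= r by rewrite ler0c; lra.
have r1 : r <= 1 by rewrite -[1]/(1%:C) lecR; lra.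
(* The shift by c lowers the cut-off by at most d, so the remainder still carries a power of r of
   exponent at least M. *)
pose N := (M + d)%N.
pose v j a := poisson_vec B r (xi j) a.
exists (pairing (fun c j i => \sum_(l < L)
    '[wordop creation c (fvec N (fun a => v j a 0 l)), fvec N (fun a => v i a 0 l)])).
  by rewrite pairing_sum; apply: sumr_ge0 => l _; exact: pairing_fock_ge0.
apply: pairing_dist => c j i cd.
under eq_bigr do rewrite dot_wordop_fvec.
rewrite exchange_big/=.
under eq_bigr do rewrite -mulmx_trmxCE.
rewrite (poisson_vec_shift r0 r1 ZZ) xik//.
set K := k c j [::] i; set rho := (_ *m _ *m _) 0 0.
have rhob : `|rho| <= sqform 1%:M (xi j) + sqform 1%:M (xi i *m (wordmx B c)^t*).
  apply: le_trans (remainder_entry_bound ZZ (N - size c) _ _).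
  by rewrite mulr2n lerDl.
have -> : K - r ^+ size c * (K - r ^+ (N - size c).*2 * rho) =
    (1 - r ^+ size c) * K + r ^+ size c * r ^+ (N - size c).*2 * rho by ring.
apply: le_trans (ler_normD _ _) _; rewrite !normrM /b mulrDr; apply: lerD.
  rewrite ler_wpM2r// ger0_norm ?subr_ge0 ?exprn_ile1//.
  rewrite /r -rmorphXn -[1]/(1%:C) -rmorphB lecR.
  apply: le_trans (bernoulli _ _) _; first by lra.
  apply: (@le_trans _ _ (d.+1%:R * s)); last by rewrite sd; lra.
  by rewrite ler_pM2r// ler_nat leqW.
have rE e : `|r ^+ e| = r ^+ e by rewrite ger0_norm// exprn_ge0.
rewrite !rE; apply: ler_pM => //; first by rewrite mulr_ge0// exprn_ge0.
rewrite -exprD; apply: (@le_trans _ _ (r ^+ M)).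
  apply: ler_wiXn2l => //; rewrite /N; lia.
by rewrite /r -rmorphXn lecR; apply: le_trans rM _; lra.
Qed.

End Pairing.

(** * Reindexing sums over words by prefixes and by reversal *)

Section WordSums.
Context {n : nat} (V : nmodType).

Lemma sum_prefix d (a : seq 'I_n) (G : seq 'I_n -> V) :
  \sum_(b <- words n d) (if prefix a b then G (drop (size a) b) else 0) =
  \sum_(c <- words n (d - size a)) G c.
Proof.
elim: a d => [|g a IH] [|d].
- by rewrite !big_nil.
- by rewrite subn0; apply: eq_bigr => b _; rewrite prefix0s drop0.
- by rewrite sub0n !big_nil.
rewrite big_words /= add0r subSS -IH (bigD1 g)//= [X in _ + X]big1 ?addr0 => [|h hg].
  by apply: eq_bigr => b _; rewrite eqxx.
by apply: big1 => b _; rewrite eq_sym (negPf hg).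
Qed.

Lemma sum_rev d (G : seq 'I_n -> V) :
  \sum_(a <- words n d) G (rev a) = \sum_(a <- words n d) G a.
Proof.
rewrite -(big_map rev xpredT G); apply: perm_big; apply: uniq_perm.
- by rewrite map_inj_uniq ?words_uniq//; exact: inv_inj revK.
- exact: words_uniq.
move=> a; rewrite -{1}[a]revK mem_map; last exact: inv_inj revK.
by rewrite !mem_words size_rev.
Qed.

End WordSums.

(** * The Toeplitz kernel of a family of operators *)

Section Toeplitz.
Context {R : realType} {H : hilbertType R} {n : nat} (T : 'I_n -> H -> H).
Hypothesis T_linear : forall g a x y, T g (a *: x + y) = a *: T g x + T g y.

Lemma wordop_linear c a x y :
  wordop T c (a *: x + y) = a *: wordop T c x + wordop T c y.
Proof. by elim: c => //= g c IH; rewrite IH T_linear. Qed.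

Lemma wordopD c x y : wordop T c (x + y) = wordop T c x + wordop T c y.
Proof. by have := wordop_linear c 1 x y; rewrite !scale1r. Qed.

Lemma wordop0 c : wordop T c 0 = 0.
Proof. by have := wordop_linear c (-1) 0 0; rewrite !scaleN1r !addNr. Qed.

Lemma wordopZ c a x : wordop T c (a *: x) = a *: wordop T c x.
Proof. by have := wordop_linear c a x 0; rewrite wordop0 !addr0. Qed.

Lemma wordop_sum c (I : Type) (s : seq I) (F : I -> H) :
  wordop T c (\sum_(i <- s) F i) = \sum_(i <- s) wordop T c (F i).
Proof.
by elim: s => [|i s IH]; rewrite ?big_nil ?wordop0// !big_cons wordopD IH.
Qed.

(* [toeplitz a x b y] is [<Psi(S_b^* S_a) x, y>], since [S_b^* S_a] is [S_c] if
   a = b c, is [S_c^*] if b = a c and vanishes otherwise; for a = b both halves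
   contribute, in accordance with [Psi I = 2 I]. *)
Definition half_toeplitz a x b y : R[i] :=
  if prefix b a then '[wordop T (drop (size b) a) x, y] else 0.

Definition toeplitz a x b y : R[i] :=
  half_toeplitz a x b y + (half_toeplitz b y a x)^*.

Lemma toeplitzC a x b y : toeplitz a x b y = (toeplitz b y a x)^*.
Proof. by rewrite /toeplitz rmorphD/= conjCK addrC. Qed.

Lemma toeplitz_cons g a x h b y :
  toeplitz (g :: a) x (h :: b) y = if g == h then toeplitz a x b y else 0.
Proof.
rewrite /toeplitz /half_toeplitz /= [h == g]eq_sym.
by case: eqP => //= _; rewrite conjC0 addr0.
Qed.

Lemma half_toeplitz_sum m a b (F G : 'I_m -> R[i]) (x y : 'I_m -> H) :
  half_toeplitz a (\sum_j F j *: x j) b (\sum_i G i *: y i) =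
  \sum_j \sum_i F j * half_toeplitz a (x j) b (y i) * (G i)^*.
Proof.
rewrite /half_toeplitz; case: ifP => _; last first.
  by rewrite big1 => // j _; rewrite big1// => i _; rewrite mulr0 mul0r.
rewrite wordop_sum linear_sumlz; apply: eq_bigr => j _.
rewrite linear_sumr; apply: eq_bigr => i _.
by rewrite wordopZ linearZl_LR linearZr_LR/= mulrCA mulrC.
Qed.

Lemma toeplitz_sum m a b (F G : 'I_m -> R[i]) (x y : 'I_m -> H) :
  toeplitz a (\sum_j F j *: x j) b (\sum_i G i *: y i) =
  \sum_j \sum_i F j * toeplitz a (x j) b (y i) * (G i)^*.
Proof.
rewrite /toeplitz !half_toeplitz_sum rmorph_sum/= [X in _ + X](eq_bigr
  (fun i => \sum_j (G i * half_toeplitz b (y i) a (x j) * (F j)^*)^*)); last first.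
  by move=> i _; rewrite rmorph_sum.
rewrite [X in _ + X]exchange_big -big_split; apply: eq_bigr => j _.
rewrite -big_split; apply: eq_bigr => i _ /=.
by rewrite !rmorphM/= conjCK; ring.
Qed.

Variable d : nat.

(* If h vanishes on the words of length at least d, this is [(I - X)^-1 h] for
   [(X g)_a = sum_j T_j g_(a j)]. *)
Definition resolvent (h : seq 'I_n -> H) a : H :=
  \sum_(c <- words n (d - size a)) wordop T c (h (a ++ c)).

(** The first halves, with a = b c, sum to [<(I - X)^-1 h, h>]; the second halves are the conjugates
    of the same terms with a and b exchanged. *)
Lemma toeplitz_form (h : seq 'I_n -> H) :
  let P := \sum_(b <- words n d) '[resolvent h b, h b] in
  \sum_(a <- words n d) \sum_(b <- words n d) toeplitz a (h a) b (h b) = P + P^*.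
Proof.
move=> P; have PE : P = \sum_(b <- words n d) \sum_(a <- words n d)
    half_toeplitz a (h a) b (h b).
  apply: eq_bigr => b _; rewrite linear_sumlz -sum_prefix.
  apply: eq_bigr => a _; rewrite /half_toeplitz; case: ifP => //.
  by move=> /prefixP[c ->]; rewrite drop_size_cat.
rewrite {1}PE [X in X + _]exchange_big/= PE rmorph_sum -big_split/=.
apply: eq_bigr => a _; rewrite rmorph_sum -big_split/=.
by apply: eq_bigr.
Qed.

(** Splitting off the first letter of c gives [(I - X)^-1 = I + X (I - X)^-1]. *)
Lemma resolventE (h : seq 'I_n -> H) a : (size a < d)%N ->
  resolvent h a = h a + \sum_j T j (resolvent h (rcons a j)).
Proof.
move=> ad; rewrite /resolvent; have -> : (d - size a = (d - (size a).+1).+1)%N by lia.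
rewrite big_words cats0/=; congr (_ + _); apply: eq_bigr => j _.
rewrite size_rcons [RHS](wordop_sum [:: j]); apply: eq_bigr => c _ /=.
by rewrite cat_rcons.
Qed.

Lemma resolvent_inv (g : seq 'I_n -> H) :
  (forall a, (d <= size a)%N -> g a = 0) ->
  forall a, resolvent (fun a => g a - \sum_j T j (g (rcons a j))) a = g a.
Proof.
(* The induction runs from long words, where both sides vanish, down to short ones. *)
move=> g0 a; have [e] := ubnP (d - size a)%N; elim: e a => // e IH a.
have [ad _|ad] := leqP d (size a).
  by rewrite /resolvent (eqP ad) big_nil g0.
rewrite ltnS => ae.
rewrite resolventE// [X in _ + X](eq_bigr (fun j => T j (g (rcons a j)))) ?subrK//.
by move=> j _; rewrite IH// size_rcons; lia.
Qed.

(** This is [<g, X g>], cut off at length d. *)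
Definition shift_sum (g : seq 'I_n -> H) : R[i] :=
  \sum_(a <- words n d) \sum_j '[g a, T j (g (rcons a j))].

(** For [h = (I - X) g] the form is [<g, (I - X) g>] plus its conjugate, that is, the form of
    [2 I - X - X^*] at g. The relation between g and h is assumed in both directions, so that either
    family may be the given one. *)
Lemma toeplitz_form_shift (g h : seq 'I_n -> H) :
  (forall a, (size a < d)%N -> resolvent h a = g a) ->
  (forall a, (size a < d)%N -> h a = g a - \sum_j T j (g (rcons a j))) ->
  \sum_(a <- words n d) \sum_(b <- words n d) toeplitz a (h a) b (h b) =
  (\sum_(a <- words n d) '[g a, g a]) *+ 2 - (shift_sum g + (shift_sum g)^*).
Proof.
move=> hg gh; rewrite toeplitz_form.
have -> : \sum_(b <- words n d) '[resolvent h b, h b] =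
    \sum_(a <- words n d) '[g a, g a] - shift_sum g.
  rewrite -sumrB big_seq [RHS]big_seq; apply: eq_bigr => a.
  rewrite mem_words => ad; rewrite hg// gh// linearBr/= linear_sumr//.
rewrite rmorphB/= [(\sum_(_ <- _) _)^*]conj_Creal; last first.
  by rewrite rpred_sum// => a _; rewrite ger0_real// dnorm_ge0.
by rewrite mulr2n; ring.
Qed.

End Toeplitz.

(** * The joint numerical radius *)

Section Radius.
Context {R : realType} {H : hilbertType R} {n : nat} (T : 'I_n -> H -> H).
Hypothesis T_linear : forall g a x y, T g (a *: x + y) = a *: T g x + T g y.

(* [shift_sum] appends letters where the joint numerical radius prepends them:
   the two are exchanged by reversing words. *)
Definition shift_bounded := forall d (g : seq 'I_n -> H),
  (forall a, (d <= size a)%N -> g a = 0) ->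
  `|shift_sum T d g| <= \sum_(a <- words n d) '[g a, g a].

Lemma op_scale j a x : T j (a *: x) = a *: T j x.
Proof. exact: (wordopZ T_linear [:: j]). Qed.

Lemma op_zero j : T j 0 = 0.
Proof. exact: (wordop0 T_linear [:: j]). Qed.

Lemma radius_shift_bounded :
  (joint_numerical_radius T <= 1)%E -> shift_bounded.
Proof.
move=> w1 d g g0; set s := \sum_(a <- _) _.
have s0 : 0 <= s by apply: sumr_ge0 => a _; exact: dnorm_ge0.
have [sz|sn0] := eqVneq s 0.
  have gz a : g a = 0.
    have [/g0//|ad] := leqP d (size a).
    move/eqP: sz; rewrite psumr_eq0 => [/allP/(_ a)|b _]; last exact: dnorm_ge0.
    by rewrite mem_words => /(_ ad); rewrite /= dnorm_eq0 => /eqP.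
  rewrite sz /shift_sum big1 ?normr0// => a _; rewrite big1// => j _.
  by rewrite gz linear0l.
have sp : 0 < s by rewrite lt_def sn0.
pose u := (sqrtC s)^-1.
have u0 : 0 <= u by rewrite invr_ge0 sqrtC_ge0.
have uu : u ^+ 2 = s^-1 by rewrite exprVn sqrtCK.
pose h a := u *: g (rev a).
have h0 a : a \notin words n d -> h a = 0.
  by rewrite mem_words -leqNgt /h => ad; rewrite g0 ?scaler0// size_rev.
have h1 : has_sum (fun a => `|h a| ^+ 2) 1.
  have -> : 1 = \sum_(a <- words n d) `|h a| ^+ 2.
    under eq_bigr do rewrite /h normrZ exprMn (ger0_norm u0) uu -hdotxx.
    by rewrite -mulr_sumr (sum_rev _ (fun a => '[g a, g a])) mulVf.
  apply: has_sum_finite; first exact: words_uniq.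
  by move=> a /h0 ->; rewrite normr0 expr0n.
have : ((complex.Re `|usum (fun a => \sum_j '[h a, T j (h (j :: a))])|)%:E <=
    joint_numerical_radius T)%E by apply: ereal_sup_ubound; exists h.
move=> /le_trans/(_ w1); rewrite (@usum_finite _ _ _ (words n d)).
- have -> : \sum_(a <- words n d) \sum_j '[h a, T j (h (j :: a))] =
      s^-1 * shift_sum T d g.
    rewrite /shift_sum -(sum_rev d) mulr_sumr; apply: eq_bigr => a _.
    rewrite mulr_sumr; apply: eq_bigr => j _.
    rewrite /h rev_cons op_scale linearZl_LR linearZr_LR/= conj_Creal ?ger0_real//.
    by rewrite revK mulrA -expr2 uu.
  rewrite lee_fin normrM ger0_norm ?invr_ge0// -lecR RRe_real; last first.
    by rewrite ger0_real// mulr_ge0// invr_ge0.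
  by rewrite mulrC ler_pdivrMr// mul1r.
- exact: words_uniq.
- by move=> a /h0 ->; rewrite big1// => j _; rewrite linear0l.
Qed.

Lemma has_sum_ge0_le (I : choiceType) (f : I -> R[i]) s (t : seq I) :
  (forall i, 0 <= f i) -> has_sum f s -> s \is Num.real -> uniq t ->
  \sum_(i <- t) f i <= s.
Proof.
move=> f0 /cvgrPdist_le fs sr ut.
apply/ler_addgt0Pr => e e0; have [A _ Ae] := fs e e0.
have /= := Ae (A `|` [fset i in t])%fset (fsubsetUl _ _).
rewrite partial_sumE => h.
apply: (@le_trans _ _ (\sum_(i <- (A `|` [fset i in t])%fset) f i)).
  have -> : \sum_(i <- t) f i =
      \sum_(i <- (A `|` [fset i in t])%fset | i \in t) f i.
    rewrite -[RHS]big_filter; apply: perm_big; apply: uniq_perm => //.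
      by rewrite filter_uniq// fset_uniq.
    by move=> i; rewrite mem_filter !inE andb_idr// => ->; rewrite orbT.
  by rewrite [leRHS](bigID (mem t))/= lerDl sumr_ge0.
rewrite -lerBlDl; apply: le_trans h; rewrite distrC.
apply: real_ler_norm; rewrite rpredB// ger0_real// sumr_ge0//.
Qed.

Lemma shift_bounded_radius :
  shift_bounded -> (joint_numerical_radius T <= 1)%E.
Proof.
move=> bT; apply: ge_ereal_sup => _ [h h1 <-]; rewrite lee_fin -lecR.
rewrite RRe_real ?normr_real//.
set f := fun a => _.
have fN N : `|\sum_(a <- words n N) f a| <= 1.
  (* The terms [f a] with a of length less than N involve [h (j :: a)], of length up to N; hence the
     truncation at [N.+1]. *)
  pose g a := if (size a < N.+1)%N then h (rev a) else 0.
  have := bT N.+1 g; have -> : shift_sum T N.+1 g = \sum_(a <- words n N) f a.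
    rewrite /shift_sum -(sum_rev N.+1).
    have sub : {subset words n N <= words n N.+1}.
      by move=> a; rewrite !mem_words => /leqW.
    rewrite (bigID (mem (words n N)))/= [X in _ + X]big_seq_cond [X in _ + X]big1.
      rewrite addr0 -big_filter; transitivity (\sum_(a <- words n N)
          \sum_j '[g (rev a), T j (g (rcons (rev a) j))]).
        apply: perm_big; apply: uniq_perm => [||a].
        - exact/filter_uniq/(words_uniq n N.+1).
        - exact: words_uniq.
        - by rewrite mem_filter andb_idr// => /sub.
      rewrite big_seq [RHS]big_seq; apply: eq_bigr => a; rewrite mem_words => aN.
      apply: eq_bigr => j _; rewrite /g size_rcons size_rev (leqW aN) ltnS aN.
      by rewrite rev_rcons revK.
    move=> a /andP[_]; rewrite mem_words => aN.
    apply: big1 => j _; have -> : g (rcons (rev a) j) = 0.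
      by rewrite /g size_rcons size_rev ltnS (negPf aN).
    by rewrite op_zero linear0r.
  move=> bg; apply: (le_trans (bg _)).
    by move=> a; rewrite /g leqNgt => /negPf ->.
  apply: (@le_trans _ _ (\sum_(a <- words n N.+1) `|h a| ^+ 2)).
    rewrite -(sum_rev N.+1) le_eqVlt; apply/orP; left; apply/eqP.
    rewrite big_seq [RHS]big_seq; apply: eq_bigr => a; rewrite mem_words => aN.
    by rewrite /g size_rev aN revK hdotxx.
  by apply: has_sum_ge0_le h1 _ _; rewrite ?rpred1 ?words_uniq// => a; rewrite exprn_ge0.
(* The bound on the sums over [words n N] passes to the limit; if there is none, [usum] takes the
   default value 0. *)
have [/cvg_ex[s fs]|/dvgP nf] := pselect (cvg
    (summability.partial_sum (f : seq 'I_n -> R[i]^o) A @[A --> summability.totally])).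
  rewrite (has_sum_usum fs); apply/ler_addgt0Pr => e e0.
  move/cvgrPdist_le: fs => /(_ e e0)[A _ Ae].
  have [N AN] : exists N, forall a, a \in A -> (size a < N)%N.
    exists (\sum_(a <- A) (size a)).+1 => a aA.
    by rewrite ltnS (big_fsetD1 a)//= leq_addr.
  have /Ae /= : (A `<=` [fset a in words n N])%fset.
    by apply/fsubsetP => a /AN aN; rewrite in_fset mem_words.
  rewrite partial_sumE (perm_big (words n N)).
    move=> h2; rewrite -[s](subrK (\sum_(a <- words n N) f a)).
    by apply: le_trans (ler_normD _ _) _; rewrite addrC lerD.
  by apply: uniq_perm; rewrite ?fset_uniq ?words_uniq// => a; rewrite in_fset.
by rewrite /usum /summability.sum nf normr0.
Qed.

End Radius.

(** * Noncommutative polynomials and the products of adjoint words with words *)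

Section Polynomials.
Context {R : realType} {n : nat}.
Implicit Types (p q : ncpoly R n) (a b c : seq 'I_n).

Lemma sum_finsupp p (s : seq (seq 'I_n)) (G : seq 'I_n -> R[i]) :
  uniq s -> {subset finsupp p <= s} ->
  \sum_(c <- finsupp p) p c * G c = \sum_(c <- s) p c * G c.
Proof.
move=> us ps; rewrite [RHS](bigID (mem (finsupp p)))/= [X in _ + X]big1 ?addr0.
  rewrite -[RHS]big_filter; apply: perm_big; apply: uniq_perm.
  - exact: fset_uniq.
  - exact: filter_uniq.
  - by move=> c; rewrite mem_filter andb_idr// => /ps.
by move=> c /fsfun_dflt ->; rewrite mul0r.
Qed.

Lemma sum_finsupp_unit p (z : R[i]) :
  \sum_(c <- finsupp p) p c * (if c == [::] then z else 0) = p [::] * z.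
Proof.
rewrite (@sum_finsupp _ (undup ([::] :: finsupp p))) ?undup_uniq//; last first.
  by move=> c cp; rewrite mem_undup in_cons cp orbT.
rewrite (bigD1_seq [::]) ?undup_uniq ?mem_undup ?mem_head//= big1 ?addr0//.
by move=> c /negPf ->; rewrite mulr0.
Qed.

Definition monomial c (x : R[i]) : ncpoly R n := [fsfun a in [fset c]%fset => x].

Lemma monomialE c x a : monomial c x a = if a == c then x else 0.
Proof. by rewrite fsfun_fun inE. Qed.

Lemma sum_monomial c x (G : seq 'I_n -> R[i]) :
  \sum_(a <- finsupp (monomial c x)) monomial c x a * G a = x * G c.
Proof.
rewrite (@sum_finsupp _ [:: c])//; first by rewrite big_seq1 monomialE eqxx.
move=> a; rewrite mem_finsupp monomialE.
by case: (a =P c) => [->|_]; rewrite ?mem_head //= eqxx.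
Qed.

(* [half_pol a b] is chosen such that [S_b^* S_a] is the value at the creation
   operators of [half_pol a b] plus the adjoint of that of [half_pol b a]. For
   a = b both contribute, hence the coefficient 1/2. *)
Definition half_pol a b : ncpoly R n :=
  if prefix b a then monomial (drop (size b) a) (if a == b then 2^-1 else 1)
  else monomial [::] 0.

(** For a = b the coefficient 1/2 counts twice, in the polynomial and as its constant term;
    otherwise the constant term vanishes. *)
Lemma half_polE (H : hilbertType R) (T : 'I_n -> H -> H) a b x y :
  \sum_(c <- finsupp (half_pol a b)) half_pol a b c * '[wordop T c x, y] +
    half_pol a b [::] * '[x, y] = half_toeplitz T a x b y.
Proof.
rewrite /half_pol /half_toeplitz; case: ifPn => [/prefixP[c ->]|_]; last first.
  by rewrite sum_monomial monomialE /= !mul0r addr0.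
rewrite drop_size_cat// sum_monomial monomialE.
case: c => [|g c]; first by rewrite cats0 eqxx /=; field.
rewrite /= mul0r addr0 ifF ?mul1r//.
by apply/negbTE/eqP => /(congr1 size)/eqP; rewrite size_cat/=; lia.
Qed.

(** Equal first letters cancel and distinct ones give 0, since the creation operators are isometries
    with orthogonal ranges; the recursion ends when a word is exhausted. *)
Lemma half_pol_creation a b (x y : fock R n) :
  \sum_(c <- finsupp (half_pol a b)) half_pol a b c * '[wordop creation c x, y] +
  (\sum_(c <- finsupp (half_pol b a)) half_pol b a c * '[wordop creation c y, x])^* =
  '[wordop creation a x, wordop creation b y].
Proof.
have half a' b' x' y' : \sum_(c <- finsupp (half_pol a' b'))
      half_pol a' b' c * '[wordop creation c x', y' : fock R n] =
    if prefix b' a' then (if a' == b' then 2^-1 else 1) *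
      '[wordop creation (drop (size b') a') x', y'] else 0.
  by rewrite /half_pol; case: ifP => _; rewrite sum_monomial ?mul0r.
rewrite !half; elim: a b => [|g a IH] [|h b].
- rewrite /= rmorphM fmorphV/= conjC_nat.
  have -> : ('[y, x])^* = '[x, y] by apply/esym; exact: dotC.
  have h2 : 2^-1 + 2^-1 = 1 :> R[i] by field.
  by rewrite -mulrDl h2 mul1r.
- rewrite /= add0r mul1r; apply/esym; exact: dotC.
- by rewrite /= conjC0 addr0 mul1r.
rewrite /= creation_dot eqseq_cons [h :: b == _]eqseq_cons [h == g]eq_sym.
by case: eqP => [_|] /=; [exact: IH|rewrite conjC0 addr0].
Qed.

End Polynomials.

(** * Equivalence of the shift bound and positivity of the Toeplitz kernel *)

Section Positivity.
Context {R : realType} {H : hilbertType R} {n : nat} (T : 'I_n -> H -> H).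
Hypothesis T_linear : forall g a x y, T g (a *: x + y) = a *: T g x + T g y.

Definition toeplitz_pos := forall d (h : seq 'I_n -> H),
  0 <= \sum_(a <- words n d) \sum_(b <- words n d) toeplitz T a (h a) b (h b).

(* Replacing [g_a] by [z^|a| g_a] with |z| = 1 multiplies [shift_sum] by [z^*]. *)
Lemma toeplitz_pos_shift_bounded : toeplitz_pos -> shift_bounded T.
Proof.
move=> Tp d g g0; set S := shift_sum T d g.
have [z z1 zS] : exists2 z : R[i], `|z| = 1 & z^* * S = `|S|.
  have [->|S0] := eqVneq S 0; first by exists 1; rewrite ?normr1// normr0 mulr0.
  exists (S / `|S|); first by rewrite normf_div normr_id divff// normr_eq0.
  rewrite rmorphM/= fmorphV/= (conj_Creal (normr_real S)).
  by rewrite mulrAC [S^* * S]mulrC -normCK expr2 mulfK// normr_eq0.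
pose g' a := z ^+ size a *: g a.
have g'0 a : (d <= size a)%N -> g' a = 0 by move=> /g0 ga; rewrite /g' ga scaler0.
have := Tp d (fun a => g' a - \sum_j T j (g' (rcons a j))).
rewrite (@toeplitz_form_shift _ _ _ _ d g') => [|a _|//]; last first.
  exact: resolvent_inv.
have -> : \sum_(a <- words n d) '[g' a, g' a] = \sum_(a <- words n d) '[g a, g a].
  by apply: eq_bigr => a _; rewrite dnormZ normrX z1 !expr1n mul1r.
have -> : shift_sum T d g' = `|S|.
  rewrite -zS /S /shift_sum mulr_sumr; apply: eq_bigr => a _.
  rewrite mulr_sumr; apply: eq_bigr => j _.
  rewrite /g' size_rcons (op_scale T_linear) linearZl_LR linearZr_LR/= exprS rmorphM/=.
  rewrite mulrA mulrCA -normCK normrX z1 !expr1n mulr1 //.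
by rewrite (conj_Creal (normr_real S)) -mulr2n subr_ge0 lerMn2r.
Qed.

(** At [g = (I - X)^-1 h] the Toeplitz form becomes [2 |g|^2 - 2 Re <g, X g>]. *)
Lemma shift_bounded_toeplitz_pos : shift_bounded T -> toeplitz_pos.
Proof.
move=> bT d h; set g := resolvent T d h.
have gd a : (d <= size a)%N -> g a = 0.
  by move=> da; rewrite /g /resolvent (eqP da) big_nil.
rewrite (@toeplitz_form_shift _ _ _ _ d g) => [|//|a ad]; last first.
  by rewrite {1}/g resolventE// addrK.
rewrite subr_ge0; set S := shift_sum T d g.
apply: (@le_trans _ _ (`|S| *+ 2)); last by rewrite lerMn2r/= bT.
apply: le_trans (real_ler_norm _) _; first by rewrite CrealE rmorphD/= conjCK addrC.
by rewrite mulr2n -{2}(norm_conjC S) ler_normD.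
Qed.

End Positivity.

(** * Complete positivity *)

Section Main.
Context {R : realType} {H : hilbertType R} {n : nat} (T : 'I_n -> H -> H).
Hypothesis T_linear : forall g a x y, T g (a *: x + y) = a *: T g x + T g y.
Hypothesis T_adj : forall g, adjointable (T g).
Implicit Types (p q : ncpoly R n).

Definition psi p q : H -> H :=
  polyop T p \+ adjoint (polyop T q) \+ (fun x => (p [::] + (q [::])^*) *: x).

Lemma dot_psi p q x y : '[psi p q x, y] =
  (\sum_(c <- finsupp p) p c * '[wordop T c x, y] + p [::] * '[x, y]) +
  (\sum_(c <- finsupp q) q c * '[wordop T c y, x] + q [::] * '[y, x])^*.
Proof.
rewrite /psi /= linearDl linearZl_LR /=.
have -> : '[polyop T p x + adjoint (polyop T q) x, y] = _ := dot_op T_adj p q x y.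
by rewrite rmorphD rmorphM/= -dotC; ring.
Qed.

(** Against the empty word, the second half of [toeplitz] survives only at [c = [::]], where it
    supplies the extra constant terms of [psi]. *)
Lemma dot_psi_toeplitz p q x y : '[psi p q x, y] =
  \sum_(c <- finsupp p) p c * toeplitz T c x [::] y +
  (\sum_(c <- finsupp q) q c * toeplitz T c y [::] x)^*.
Proof.
have half (r : ncpoly R n) u v : \sum_(c <- finsupp r) r c * toeplitz T c u [::] v =
    \sum_(c <- finsupp r) r c * '[wordop T c u, v] + r [::] * '[u, v].
  rewrite -(sum_finsupp_unit r) -big_split; apply: eq_bigr => c _ /=.
  rewrite -mulrDr /toeplitz /half_toeplitz prefix0s drop0; congr (_ * (_ + _)).
  case: c => [|g c] /=; last by rewrite conjC0.
  by apply/esym; exact: dotC.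
by rewrite dot_psi !half.
Qed.

Lemma dot_inj (u v : H) : (forall y, '[u, y] = '[v, y]) -> u = v.
Proof.
move=> uv; apply/eqP; rewrite -subr_eq0 -normr_eq0 -sqrf_eq0 -hdotxx.
by rewrite linearBl subr_eq0; apply/eqP; exact: uv.
Qed.

Definition creation_op p q : fock R n -> fock R n :=
  polyop creation p \+ adjoint (polyop creation q).

Lemma dot_creation_op p q x y : '[creation_op p q x, y] =
  \sum_(c <- finsupp p) p c * '[wordop creation c x, y] +
  (\sum_(c <- finsupp q) q c * '[wordop creation c y, x])^*.
Proof. exact: (dot_op (@adjointable_creation R n)). Qed.

Lemma dot_wordop_basis c a b :
  '[wordop creation c (basis a), basis b : fock R n] = if c ++ a == b then 1 else 0.
Proof.
rewrite wordop_creation_basis; apply: (etrans (dot_basis _ _)) => /=.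
by case: eqP => _; rewrite ?conjC1 ?conjC0.
Qed.

Lemma creation_op_coef p q c : '[creation_op p q (basis [::]), basis c] =
  p c + if c == [::] then (q [::])^* else 0.
Proof.
apply: (etrans (dot_creation_op _ _ _ _)); congr (_ + _).
  rewrite (@sum_finsupp _ _ _ (undup (c :: finsupp p))) ?undup_uniq//; last first.
    by move=> a ap; rewrite mem_undup in_cons ap orbT.
  rewrite (bigD1_seq c) ?undup_uniq ?mem_undup ?mem_head//=.
  rewrite dot_wordop_basis cats0 eqxx mulr1 big1 ?addr0// => a ac.
  by rewrite dot_wordop_basis cats0 (negPf ac) mulr0.
under eq_bigr do rewrite dot_wordop_basis.
case: (altP (c =P [::])) => [->|c0].
  under eq_bigr do rewrite cats0.
  by rewrite sum_finsupp_unit mulr1.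
rewrite big1 ?conjC0// => a _; case: eqP; last by rewrite mulr0.
by move=> /(congr1 size)/eqP; rewrite size_cat addn_eq0 !size_eq0 (negPf c0) andbF.
Qed.

Lemma creation_op_adjoint p q x y :
  '[creation_op p q x, y] = ('[creation_op q p y, x])^*.
Proof.
rewrite [LHS]dot_creation_op [X in _ = X^*]dot_creation_op rmorphD/= conjCK.
by rewrite addrC.
Qed.

(* [psi p q] depends only on [p c] and [q c] for c nonempty and on
   [p(0) + q(0)^*], which are matrix coefficients of [creation_op p q]. *)
Lemma creation_op_inj p q p' q' : creation_op p q = creation_op p' q' ->
  psi p q = psi p' q'.
Proof.
move=> e; have pq c : p c + (if c == [::] then (q [::])^* else 0) =
    p' c + (if c == [::] then (q' [::])^* else 0).
  by rewrite -!creation_op_coef e.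
(* The coefficients of q are read off from the adjoint operator, which exchanges p and q. *)
have qp c : q c + (if c == [::] then (p [::])^* else 0) =
    q' c + (if c == [::] then (p' [::])^* else 0).
  rewrite -!creation_op_coef.
  apply: etrans (creation_op_adjoint q p _ _) _; rewrite e.
  exact: esym (creation_op_adjoint q' p' _ _).
have tail (r r' : ncpoly R n) x y : (forall c, c != [::] -> r c = r' c) ->
    \sum_(c <- finsupp r) r c * '[wordop T c x, y] - r [::] * '[x, y] =
    \sum_(c <- finsupp r') r' c * '[wordop T c x, y] - r' [::] * '[x, y].
  move=> rr; pose s := undup ([::] :: finsupp r ++ finsupp r').
  have us : uniq s by exact: undup_uniq.
  have rs : {subset finsupp r <= s}.
    by move=> c cr; rewrite mem_undup in_cons mem_cat cr orbT.
  have rs' : {subset finsupp r' <= s}.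
    by move=> c cr; rewrite mem_undup in_cons mem_cat cr !orbT.
  pose G c := '[wordop T c x, y].
  rewrite (sum_finsupp G us rs) (sum_finsupp G us rs').
  have s0 : [::] \in s by rewrite mem_undup mem_head.
  rewrite !(bigD1_seq [::] s0 us)/= ![_ * _ + _]addrC !addrK.
  by apply: eq_bigr => c /rr ->.
apply/funext => x; apply: dot_inj => y; rewrite !dot_psi.
have tp : forall c, c != [::] -> p c = p' c.
  by move=> c c0; have := pq c; rewrite (negPf c0) !addr0.
have tq : forall c, c != [::] -> q c = q' c.
  by move=> c c0; have := qp c; rewrite (negPf c0) !addr0.
have := tail p p' x y tp; have := tail q q' y x tq.
have := pq [::]; rewrite eqxx.
set P := \sum_(c <- finsupp p) _; set P' := \sum_(c <- finsupp p') _.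
set Q := \sum_(c <- finsupp q) _; set Q' := \sum_(c <- finsupp q') _.
move=> e0 eQ eP.
have -> : P = P' - p' [::] * '[x, y] + p [::] * '[x, y] by rewrite -eP subrK.
have -> : Q = Q' - q' [::] * '[y, x] + q [::] * '[y, x] by rewrite -eQ subrK.
rewrite !rmorphD rmorphN !rmorphM/= -!dotC.
have -> : p [::] = p' [::] + (q' [::])^* - (q [::])^* by rewrite -e0 addrK.
ring.
Qed.

Lemma psi_toeplitz_pos (Psi : (fock R n -> fock R n) -> (H -> H)) :
  (forall p q, Psi (creation_op p q) = psi p q) ->
  completely_positive (@opsystem R n) Psi -> toeplitz_pos T.
Proof.
move=> PsiE cp d h; set W := words n d.
pose wd (i : 'I_(size W)) := nth [::] W i.
pose A : 'M[fock R n -> fock R n]_(size W) := \matrix_(i, j)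
  creation_op (half_pol (wd j) (wd i)) (half_pol (wd i) (wd j)).
have WE (F : seq 'I_n -> seq 'I_n -> R[i]) : \sum_(a <- W) \sum_(b <- W) F a b =
    \sum_i \sum_j F (wd j) (wd i).
  rewrite exchange_big (big_nth [::]) big_mkord; apply: eq_bigr => i _.
  by rewrite (big_nth [::]) big_mkord.
rewrite WE.
have AS i j : @opsystem R n (A i j).
  by rewrite mxE; exists (half_pol (wd j) (wd i)), (half_pol (wd i) (wd j)).
have Apos : pos_opmx A.
  (* The entry (i, j) of A is the product of the adjoint of the word [wd i] with the word [wd j], so
     the form of A at x is [<z, z>]. *)
  move=> x; pose z := \sum_j wordop creation (wd j) (x j) : fock R n.
  suff -> : \sum_i \sum_j '[A i j (x j), x i] = '[z, z] by exact: dnorm_ge0.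
  rewrite [RHS]linear_sumr; apply: eq_bigr => i _.
  rewrite [RHS]linear_sumlz; apply: eq_bigr => j _.
  rewrite mxE; apply: (etrans (dot_creation_op _ _ _ _)).
  exact: half_pol_creation.
have := cp _ A AS Apos (fun i => h (wd i)); congr (_ <= _).
apply: eq_bigr => i _; apply: eq_bigr => j _.
by rewrite !mxE PsiE dot_psi !half_polE.
Qed.

Lemma toeplitz_pos_psi : toeplitz_pos T ->
  exists Psi : (fock R n -> fock R n) -> (H -> H),
    (forall p q, Psi (creation_op p q) = psi p q) /\
    completely_positive (@opsystem R n) Psi.
Proof.
(* Psi is the relation between [creation_op p q] and [psi p q], single-valued by [creation_op_inj];
   outside the operator system it is 0. *)
move=> Tp; pose Psi s : H -> H := xget (fun=> 0)
  [set f | exists p q, s = creation_op p q /\ f = psi p q].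
have PsiE p q : Psi (creation_op p q) = psi p q.
  rewrite /Psi; case: xgetP => [f _ [p' [q' [e ->]]]|].
    exact/esym/creation_op_inj.
  by move=> /(_ (psi p q)) []; exists p, q.
exists Psi; split=> // m A AS Apos x.
have /choice[pq Apq] (ij : 'I_m * 'I_m) : exists pq : ncpoly R n * ncpoly R n,
    A ij.1 ij.2 = creation_op pq.1 pq.2.
  by have [p [q ->]] := AS ij.1 ij.2; exists (p, q).
pose p i j := (pq (i, j)).1; pose q i j := (pq (i, j)).2.
have {}Apq i j : A i j = creation_op (p i j) (q i j) := Apq (i, j).
pose len (r : ncpoly R n) := (\sum_(c <- finsupp r) size c)%N.
have lenP (r : ncpoly R n) c : c \in finsupp r -> (size c <= len r)%N.
  by move=> cr; rewrite /len (big_fsetD1 c)//= leq_addr.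
(* A common bound for the lengths of all words occurring in the entries of A. *)
pose d := (\sum_i \sum_j (len (p i j) + len (q i j)))%N.
have ijd i j : (len (p i j) + len (q i j) <= d)%N.
  by rewrite /d (bigD1 i)//= (bigD1 j)//= -addnA leq_addr.
suff -> : \sum_i \sum_j '[map_mx Psi A i j (x j), x i] =
    pairing p q (fun c j i => toeplitz T c (x j) [::] (x i)).
  apply: (@pairing_kernel_ge0 _ _ _ p q d _ _ _
    (fun a j b i => toeplitz T a (x j) b (x i))).
  - by move=> i j c /lenP/leq_trans; apply; apply: leq_trans (ijd i j); exact: leq_addr.
  - by move=> i j c /lenP/leq_trans; apply; apply: leq_trans (ijd i j); exact: leq_addl.
  - move=> y; have := Apos y; congr (_ <= _).
    apply: eq_bigr => i _; apply: eq_bigr => j _.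
    by rewrite Apq; exact: dot_creation_op.
  - by move=> a j b i; exact: toeplitzC.
  (* Positivity of the kernel at the vectors [x j] is [toeplitz_pos] at the combinations
     [\sum_j f a j *: x j]. *)
  - move=> f; have := Tp d.+1 (fun a => \sum_j f a j *: x j); congr (_ <= _).
    apply: eq_bigr => a _; rewrite [RHS]exchange_big; apply: eq_bigr => b _.
    exact: toeplitz_sum.
  - by move=> g a j h b i; exact: toeplitz_cons.
apply: eq_bigr => i _; apply: eq_bigr => j _.
by rewrite mxE Apq PsiE dot_psi_toeplitz.
Qed.

End Main.

Theorem theorem1p3 (R : realType) (H : hilbertType R) (n : nat) (n_gt0 : (0 < n)%N)
    (T : 'I_n -> {linear H -> H}) (T_continuous : forall i, continuous (T i)) :
  (joint_numerical_radius T <= 1)%E <->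
  exists Psi : (fock R n -> fock R n) -> (H -> H),
    (forall p q : ncpoly R n,
       Psi (polyop creation p \+ adjoint (polyop creation q)) =
       polyop T p \+ adjoint (polyop T q) \+
         (fun x => (p [::] + (q [::])^*) *: x)) /\
    completely_positive (@opsystem R n) Psi.
Proof.
have T_lin g a x y : T g (a *: x + y) = a *: T g x + T g y := linearP (T g) a x y.
have T_adj g := adjointable_continuous (T_continuous g).
split=> [w1|[Psi [PsiE cp]]].
  apply: (toeplitz_pos_psi T_lin T_adj).
  exact/(shift_bounded_toeplitz_pos T_lin)/(radius_shift_bounded T_lin).
apply/(shift_bounded_radius T_lin)/(toeplitz_pos_shift_bounded T_lin).
exact: (psi_toeplitz_pos T_adj PsiE cp).
Qed.
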